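(* Let $R$ be a commutative ring, $\sigma\in\mathrm{Aut}(R)$ with $\sigma^p=\mathrm{Id}_R$, $\omega=\{\mathfrak m_0,\dots,\sigma^{p-1}(\mathfrak m_0)\}$ a $\sigma$-orbit in $\mathrm{MaxSpec}(R)$ with $p$ elements, $\Bbbk=R/\mathfrak m_0$, and $t\in R$ a regular element. Let $w=w_1w_2\cdots w_{rp}\in\mathbf D^t_\omega$ and $F\in\mathrm{Aut}_\Bbbk(\Bbbk^d)$. Then there is an isomorphism of $A(t)$-modules $$V^1(\omega,1^p,F)\otimes_RV^t(\omega,w,x-1)\simeq V^t(\omega,w,F^r).$$
   Context: $A(t)$ is the ring generated over $R$ by $X,Y$ with $Xr=\sigma(r)X$, $Yr=\sigma^{-1}(r)Y$ ($r\in R$), $YX=t$, $XY=\sigma(t)$. A weight module is an $A(t)$-module $M=\bigoplus_{\mathfrak m\in\mathrm{MaxSpec}(R)}M_{\mathfrak m}$, $M_{\mathfrak m}=\{v\mid\mathfrak mv=0\}$. For a weight $A(t)$-module $M$ and a weight $A(t')$-module $M'$, $M\otimes_RM'$ is an $A(tt')$-module via $X(v\otimes v')=Xv\otimes Xv'$, $Y(v\otimes v')=Yv\otimes Yv'$. $B^t_\omega=\{\mathfrak m\in\omega\mid t\in\mathfrak m\}$. $\mathbf D^t_\omega$ is the set of indexed words $w=w_jw_{j+1}\cdots w_{j+m}$ with letters $w_k\in\{1,x,y,0\}$ such that $w_k=1$ iff $\sigma^k(\mathfrak m_0)\notin B^t_\omega$. For $w=w_1\cdots w_{rp}\in\mathbf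 D^t_\omega$ and $F\in\mathrm{Aut}_\Bbbk(\Bbbk^d)$ (an invertible matrix), $V^t(\omega,w,F)=\bigoplus_{1\le k\le rp,\,1\le s\le d}(R/\sigma^k(\mathfrak m_0))e^t_{k,s}$ with $Xe^t_{k,s}=\sigma(t)e^t_{k+1,s}$ if $k\ne rp,w_k=1$; $e^t_{k+1,s}$ if $k\ne rp,w_k=x$; $\sigma(t)\sigma(F)e^t_{1,s}$ if $k=rp,w_{rp}=1$; $\sigma(F)e^t_{1,s}$ if $k=rp,w_{rp}=x$; $0$ if $w_k\in\{y,0\}$; $Ye^t_{k,s}=e^t_{k-1,s}$ if $k\ne1,w_{k-1}\in\{1,y\}$; $F^{-1}e^t_{rp,s}$ if $k=1,w_{rp}\in\{1,y\}$; $0$ if the preceding letter ($w_{k-1}$, or $w_{rp}$ when $k=1$) is in $\{x,0\}$. Here $\Bbbk^d$ is identified with $\bigoplus_s\Bbbk e^t_{rp,s}$, and $\sigma(F)$ is the matrix over $R/\sigma(\mathfrak m_0)$ obtained from $F$ via the isomorphism $R/\mathfrak m_0\to R/\sigma(\mathfrak m_0)$ induced by $\sigma$; $X,Y$ extend by $X(rv)=\sigma(r)Xv$, $Y(rv)=\sigma^{-1}(r)Yv$. $V^t(\omega,w,x-1)$ is the case $d=1$, $F=(1)$. For $t=1$ one has $B^1_\omega=\emptyset$ and the word $1^p$ is in $\mathbf D^1_\omega$. *)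

(* Defs.v *)
From HB Require Import structures.
From mathcomp Require Import all_boot all_order all_algebra.
From mathcomp Require Import boolp classical_sets functions cardinality.

Set Implicit Arguments.
Unset Strict Implicit.
Unset Printing Implicit Defensive.

Import GRing.Theory.

Local Open Scope ring_scope.
Local Open Scope quotient_scope.

Record ringAut (R : pzRingType) := RingAut {
  aut_fun :> {rmorphism R -> R};
  aut_inv : R -> R;
  aut_funK : cancel aut_fun aut_inv;
  aut_invK : cancel aut_inv aut_fun
}.

Section RingAutTheory.
Variables (R : pzRingType) (sigma : ringAut R).

Lemma aut_inv_zmod_morphism : zmod_morphism (aut_inv sigma).
Proof. exact: can2_zmod_morphism (@aut_funK _ sigma) (@aut_invK _ sigma). Qed.

Lemma aut_inv_monoid_morphism : monoid_morphism (aut_inv sigma).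
Proof. exact: can2_monoid_morphism (@aut_funK _ sigma) (@aut_invK _ sigma). Qed.

HB.instance Definition _ :=
  GRing.isZmodMorphism.Build R R (aut_inv sigma) aut_inv_zmod_morphism.
HB.instance Definition _ :=
  GRing.isMonoidMorphism.Build R R (aut_inv sigma) aut_inv_monoid_morphism.

End RingAutTheory.

(* gwa sigma t is A(t), the ring presented by generators (the elements of R, X
   and Y) and relations: formal ring expressions modulo the least congruence
   containing the ring axioms, the operations of R and the relations between
   X, Y and R. *)

Inductive gwa_term (R : Type) : Type :=
  | TC of R
  | TX
  | TY
  | TOpp of gwa_term R
  | TAdd of gwa_term R & gwa_term R
  | TMul of gwa_term R & gwa_term R.
Arguments TX {R}.
Arguments TY {R}.

Section GWA.
Variables (R : comNzRingType) (sigma : ringAut R) (t : R).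

Inductive gwa_cong : gwa_term R -> gwa_term R -> Prop :=
  | gc_refl a : gwa_cong a a
  | gc_sym a b : gwa_cong a b -> gwa_cong b a
  | gc_trans a b c : gwa_cong a b -> gwa_cong b c -> gwa_cong a c
  | gc_opp a b : gwa_cong a b -> gwa_cong (TOpp a) (TOpp b)
  | gc_add a b c d :
      gwa_cong a b -> gwa_cong c d -> gwa_cong (TAdd a c) (TAdd b d)
  | gc_mul a b c d :
      gwa_cong a b -> gwa_cong c d -> gwa_cong (TMul a c) (TMul b d)
  | gc_addA a b c : gwa_cong (TAdd a (TAdd b c)) (TAdd (TAdd a b) c)
  | gc_addC a b : gwa_cong (TAdd a b) (TAdd b a)
  | gc_add0 a : gwa_cong (TAdd (TC 0) a) a
  | gc_addN a : gwa_cong (TAdd (TOpp a) a) (TC 0)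
  | gc_mulA a b c : gwa_cong (TMul a (TMul b c)) (TMul (TMul a b) c)
  | gc_mul1l a : gwa_cong (TMul (TC 1) a) a
  | gc_mul1r a : gwa_cong (TMul a (TC 1)) a
  | gc_mulDl a b c :
      gwa_cong (TMul (TAdd a b) c) (TAdd (TMul a c) (TMul b c))
  | gc_mulDr a b c :
      gwa_cong (TMul a (TAdd b c)) (TAdd (TMul a b) (TMul a c))
  | gc_CD r s : gwa_cong (TC (r + s)) (TAdd (TC r) (TC s))
  | gc_CM r s : gwa_cong (TC (r * s)) (TMul (TC r) (TC s))
  | gc_XC r : gwa_cong (TMul TX (TC r)) (TMul (TC (sigma r)) TX)
  | gc_YC r : gwa_cong (TMul TY (TC r)) (TMul (TC (aut_inv sigma r)) TY)
  | gc_YX : gwa_cong (TMul TY TX) (TC t)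
  | gc_XY : gwa_cong (TMul TX TY) (TC (sigma t)).

HB.instance Definition _ := gen_eqMixin (gwa_term R).
HB.instance Definition _ := gen_choiceMixin (gwa_term R).

Definition gwa_congb (a b : gwa_term R) : bool := `[< gwa_cong a b >].

Lemma gwa_congb_class : equiv_class_of gwa_congb.
Proof.
split=> [a|a b|b a c].
- by apply/asboolP; exact: gc_refl.
- by apply/asboolP/asboolP; exact: gc_sym.
- by move=> /asboolP ab /asboolP bc; apply/asboolP; exact: gc_trans ab bc.
Qed.

Canonical gwa_cong_equiv := EquivRelPack gwa_congb_class.
Canonical gwa_cong_encModRel := defaultEncModRel gwa_congb.

Definition gwa := {eq_quot gwa_congb}.
HB.instance Definition _ : EqQuotient _ gwa_congb gwa := EqQuotient.on gwa.
HB.instance Definition _ := Choice.on gwa.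

Lemma gwa_piP (a b : gwa_term R) :
  \pi_gwa a = \pi_gwa b <-> gwa_cong a b.
Proof.
split=> [/eqP|ab]; first by rewrite piE => /asboolP.
by apply/eqP; rewrite piE; apply/asboolP.
Qed.

Lemma gwa_reprP (a : gwa_term R) : gwa_cong (repr (\pi_gwa a)) a.
Proof. by apply/gwa_piP; rewrite reprK. Qed.

Lemma gwa_ind (P : gwa -> Prop) : (forall a, P (\pi_gwa a)) -> forall u, P u.
Proof. by move=> h u; rewrite -(reprK u). Qed.

Definition gwa_opp (u : gwa) : gwa := \pi_gwa (TOpp (repr u)).
Definition gwa_add (u v : gwa) : gwa := \pi_gwa (TAdd (repr u) (repr v)).
Definition gwa_mul (u v : gwa) : gwa := \pi_gwa (TMul (repr u) (repr v)).

Lemma gwa_pi_opp a : gwa_opp (\pi_gwa a) = \pi_gwa (TOpp a).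
Proof. by apply/gwa_piP/gc_opp/gwa_reprP. Qed.
Lemma gwa_pi_add a b : gwa_add (\pi_gwa a) (\pi_gwa b) = \pi_gwa (TAdd a b).
Proof. by apply/gwa_piP/gc_add; exact: gwa_reprP. Qed.
Lemma gwa_pi_mul a b : gwa_mul (\pi_gwa a) (\pi_gwa b) = \pi_gwa (TMul a b).
Proof. by apply/gwa_piP/gc_mul; exact: gwa_reprP. Qed.

Let piE' := (gwa_pi_opp, gwa_pi_add, gwa_pi_mul).

Lemma gwa_addA : associative gwa_add.
Proof.
elim/gwa_ind=> a; elim/gwa_ind=> b; elim/gwa_ind=> c; rewrite !piE'.
by apply/gwa_piP/gc_addA.
Qed.
Lemma gwa_addC : commutative gwa_add.
Proof.
by elim/gwa_ind=> a; elim/gwa_ind=> b; rewrite !piE'; apply/gwa_piP/gc_addC.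
Qed.
Lemma gwa_add0 : left_id (\pi_gwa (TC 0)) gwa_add.
Proof. by elim/gwa_ind=> a; rewrite !piE'; apply/gwa_piP/gc_add0. Qed.
Lemma gwa_addN : left_inverse (\pi_gwa (TC 0)) gwa_opp gwa_add.
Proof. by elim/gwa_ind=> a; rewrite !piE'; apply/gwa_piP/gc_addN. Qed.
Lemma gwa_mulA : associative gwa_mul.
Proof.
elim/gwa_ind=> a; elim/gwa_ind=> b; elim/gwa_ind=> c; rewrite !piE'.
by apply/gwa_piP/gc_mulA.
Qed.
Lemma gwa_mul1l : left_id (\pi_gwa (TC 1)) gwa_mul.
Proof. by elim/gwa_ind=> a; rewrite !piE'; apply/gwa_piP/gc_mul1l. Qed.
Lemma gwa_mul1r : right_id (\pi_gwa (TC 1)) gwa_mul.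
Proof. by elim/gwa_ind=> a; rewrite !piE'; apply/gwa_piP/gc_mul1r. Qed.
Lemma gwa_mulDl : left_distributive gwa_mul gwa_add.
Proof.
elim/gwa_ind=> a; elim/gwa_ind=> b; elim/gwa_ind=> c; rewrite !piE'.
by apply/gwa_piP/gc_mulDl.
Qed.
Lemma gwa_mulDr : right_distributive gwa_mul gwa_add.
Proof.
elim/gwa_ind=> a; elim/gwa_ind=> b; elim/gwa_ind=> c; rewrite !piE'.
by apply/gwa_piP/gc_mulDr.
Qed.

HB.instance Definition _ :=
  GRing.isZmodule.Build gwa gwa_addA gwa_addC gwa_add0 gwa_addN.
HB.instance Definition _ := GRing.Zmodule_isPzRing.Build gwa
  gwa_mulA gwa_mul1l gwa_mul1r gwa_mulDl gwa_mulDr.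

Definition gwaC (r : R) : gwa := \pi_gwa (TC r).
Definition gwaX : gwa := \pi_gwa TX.
Definition gwaY : gwa := \pi_gwa TY.

Lemma gwaCD : {morph gwaC : r s / r + s}.
Proof.
by move=> r s; rewrite [RHS]gwa_pi_add; apply/gwa_piP/gc_CD.
Qed.
Lemma gwaCM : {morph gwaC : r s / r * s}.
Proof.
by move=> r s; rewrite [RHS]gwa_pi_mul; apply/gwa_piP/gc_CM.
Qed.
Lemma gwaC1 : gwaC 1 = 1. Proof. by []. Qed.
Lemma gwaXC r : gwaX * gwaC r = gwaC (sigma r) * gwaX.
Proof. by rewrite [LHS]gwa_pi_mul [RHS]gwa_pi_mul; apply/gwa_piP/gc_XC. Qed.
Lemma gwaYC r : gwaY * gwaC r = gwaC (aut_inv sigma r) * gwaY.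
Proof. by rewrite [LHS]gwa_pi_mul [RHS]gwa_pi_mul; apply/gwa_piP/gc_YC. Qed.
Lemma gwaYX : gwaY * gwaX = gwaC t.
Proof. by rewrite [LHS]gwa_pi_mul; apply/gwa_piP/gc_YX. Qed.
Lemma gwaXY : gwaX * gwaY = gwaC (sigma t).
Proof. by rewrite [LHS]gwa_pi_mul; apply/gwa_piP/gc_XY. Qed.

End GWA.

(* gwa_res M is M seen as an R-module through R -> A(t). *)
Section Restriction.
Variables (R : comNzRingType) (sigma : ringAut R) (t : R).
Variable M : lmodType (gwa sigma t).

Definition gwa_res : Type := M.
HB.instance Definition _ := GRing.Zmodule.on gwa_res.

Definition gwa_res_scale (r : R) (v : gwa_res) : gwa_res :=
  gwaC sigma t r *: (v : M).

Fact gwa_res_scaleA a b v :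
  gwa_res_scale a (gwa_res_scale b v) = gwa_res_scale (a * b) v.
Proof. by rewrite /gwa_res_scale scalerA gwaCM. Qed.
Fact gwa_res_scale1 : left_id 1 gwa_res_scale.
Proof. by move=> v; rewrite /gwa_res_scale gwaC1 scale1r. Qed.
Fact gwa_res_scaleDr : right_distributive gwa_res_scale +%R.
Proof. by move=> a u v; rewrite /gwa_res_scale scalerDr. Qed.
Fact gwa_res_scaleDl v : {morph gwa_res_scale^~ v : a b / a + b}.
Proof. by move=> a b; rewrite /gwa_res_scale gwaCD scalerDl. Qed.

HB.instance Definition _ := GRing.Zmodule_isLmodule.Build R gwa_res
  gwa_res_scaleA gwa_res_scale1 gwa_res_scaleDr gwa_res_scaleDl.

End Restriction.

(* An R-module with operators X and Y satisfying the defining relations of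
   A(t); gwa_mod turns it into an A(t)-module. *)
Record gwa_rep (R : comNzRingType) (sigma : ringAut R) (t : R) := GwaRep {
  rep_mod :> lmodType R;
  repX : rep_mod -> rep_mod;
  repY : rep_mod -> rep_mod;
  repXD : {morph repX : u v / u + v};
  repYD : {morph repY : u v / u + v};
  repXZ : forall r v, repX (r *: v) = sigma r *: repX v;
  repYZ : forall r v, repY (r *: v) = aut_inv sigma r *: repY v;
  repYX : forall v, repY (repX v) = t *: v;
  repXY : forall v, repX (repY v) = sigma t *: v
}.

Section RepModule.
Variables (R : comNzRingType) (sigma : ringAut R) (t : R).
Variable V : gwa_rep sigma t.

Fixpoint rep_eval (a : gwa_term R) (v : V) : V :=
  match a with
  | TC r => r *: v
  | TX => repX v
  | TY => repY v
  | TOpp a => - rep_eval a v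
  | TAdd a b => rep_eval a v + rep_eval b v
  | TMul a b => rep_eval a (rep_eval b v)
  end.

Lemma rep_evalD a : {morph rep_eval a : u v / u + v}.
Proof.
elim: a => [r|||a iha|a iha b ihb|a iha b ihb] u v /=.
- exact: scalerDr.
- exact: repXD.
- exact: repYD.
- by rewrite iha opprD.
- by rewrite iha ihb addrACA.
- by rewrite ihb iha.
Qed.

Lemma rep_eval_cong a b : gwa_cong sigma t a b -> rep_eval a =1 rep_eval b.
Proof.
elim=> {a b} //=.
- by move=> a b _ ab v; rewrite ab.
- by move=> a b c _ ab _ bc v; rewrite ab bc.
- by move=> a b _ ab v; rewrite ab.
- by move=> a b c d _ ab _ cd v; rewrite ab cd.
- by move=> a b c d _ ab _ cd v; rewrite cd ab.
- by move=> a b c v; rewrite addrA.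
- by move=> a b v; rewrite addrC.
- by move=> a v; rewrite scale0r add0r.
- by move=> a v; rewrite addNr scale0r.
- by move=> a v; rewrite scale1r.
- by move=> a v; rewrite scale1r.
- by move=> a b c v; rewrite rep_evalD.
- by move=> r s v; rewrite scalerDl.
- by move=> r s v; rewrite scalerA.
- by move=> r v; rewrite repXZ.
- by move=> r v; rewrite repYZ.
- by move=> v; rewrite repYX.
- by move=> v; rewrite repXY.
Qed.

Definition gwa_mod : Type := V.
HB.instance Definition _ := GRing.Zmodule.on gwa_mod.

Definition gwa_mod_scale (u : gwa sigma t) (v : gwa_mod) : gwa_mod :=
  rep_eval (repr u) v.

Lemma gwa_mod_scale_pi a v : gwa_mod_scale (\pi a) v = rep_eval a v.
Proof. by apply: rep_eval_cong; exact: gwa_reprP. Qed.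

Fact gwa_mod_scaleA a b v :
  gwa_mod_scale a (gwa_mod_scale b v) = gwa_mod_scale (a * b) v.
Proof. by rewrite [in RHS]/GRing.mul /= gwa_mod_scale_pi. Qed.
Fact gwa_mod_scale1 : left_id 1 gwa_mod_scale.
Proof. by move=> v; rewrite gwa_mod_scale_pi /= scale1r. Qed.
Fact gwa_mod_scaleDr : right_distributive gwa_mod_scale +%R.
Proof. by move=> a u v; exact: rep_evalD. Qed.
Fact gwa_mod_scaleDl v : {morph gwa_mod_scale^~ v : a b / a + b}.
Proof. by move=> a b; rewrite [in LHS]/GRing.add /= gwa_mod_scale_pi. Qed.

HB.instance Definition _ := GRing.Zmodule_isLmodule.Build (gwa sigma t) gwa_mod
  gwa_mod_scaleA gwa_mod_scale1 gwa_mod_scaleDr gwa_mod_scaleDl.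

Lemma gwa_mod_C r (v : gwa_mod) : gwaC sigma t r *: v = (r *: (v : V) : V).
Proof. exact: gwa_mod_scale_pi. Qed.
Lemma gwa_mod_X (v : gwa_mod) : gwaX sigma t *: v = repX (v : V).
Proof. exact: gwa_mod_scale_pi. Qed.
Lemma gwa_mod_Y (v : gwa_mod) : gwaY sigma t *: v = repY (v : V).
Proof. exact: gwa_mod_scale_pi. Qed.

End RepModule.

(* tensor U V is the R-module generated by the symbols u (x) v (TPure u v)
   subject to bilinearity: formal R-linear expressions in these symbols modulo
   the least congruence containing the module axioms and bilinearity. *)

Inductive tens_term (R U V : Type) : Type :=
  | TZero
  | TPure of U & V
  | TNeg of tens_term R U V
  | TSum of tens_term R U V & tens_term R U V
  | TScale of R & tens_term R U V.
Arguments TZero {R U V}.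
Arguments TPure {R U V}.
Arguments TNeg {R U V}.
Arguments TSum {R U V}.
Arguments TScale {R U V}.

Section Tensor.
Variables (R : comNzRingType) (U V : lmodType R).
Local Notation term := (tens_term R U V).

Inductive tens_cong : term -> term -> Prop :=
  | tc_refl a : tens_cong a a
  | tc_sym a b : tens_cong a b -> tens_cong b a
  | tc_trans a b c : tens_cong a b -> tens_cong b c -> tens_cong a c
  | tc_opp a b : tens_cong a b -> tens_cong (TNeg a) (TNeg b)
  | tc_add a b c d :
      tens_cong a b -> tens_cong c d -> tens_cong (TSum a c) (TSum b d)
  | tc_scale r a b : tens_cong a b -> tens_cong (TScale r a) (TScale r b)
  | tc_addA a b c : tens_cong (TSum a (TSum b c)) (TSum (TSum a b) c)
  | tc_addC a b : tens_cong (TSum a b) (TSum b a)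
  | tc_add0 a : tens_cong (TSum TZero a) a
  | tc_addN a : tens_cong (TSum (TNeg a) a) TZero
  | tc_scaleA r s a : tens_cong (TScale r (TScale s a)) (TScale (r * s) a)
  | tc_scale1 a : tens_cong (TScale 1 a) a
  | tc_scaleDr r a b :
      tens_cong (TScale r (TSum a b)) (TSum (TScale r a) (TScale r b))
  | tc_scaleDl r s a :
      tens_cong (TScale (r + s) a) (TSum (TScale r a) (TScale s a))
  | tc_pureDl u u' v :
      tens_cong (TPure (u + u') v) (TSum (TPure u v) (TPure u' v))
  | tc_pureDr u v v' :
      tens_cong (TPure u (v + v')) (TSum (TPure u v) (TPure u v'))
  | tc_pureZl r u v : tens_cong (TPure (r *: u) v) (TScale r (TPure u v))
  | tc_pureZr r u v : tens_cong (TPure u (r *: v)) (TScale r (TPure u v)).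

HB.instance Definition _ := gen_eqMixin (tens_term R U V).
HB.instance Definition _ := gen_choiceMixin (tens_term R U V).

Definition tens_congb (a b : term) : bool := `[< tens_cong a b >].

Lemma tens_congb_class : equiv_class_of tens_congb.
Proof.
split=> [a|a b|b a c].
- by apply/asboolP; exact: tc_refl.
- by apply/asboolP/asboolP; exact: tc_sym.
- by move=> /asboolP ab /asboolP bc; apply/asboolP; exact: tc_trans ab bc.
Qed.

Canonical tens_cong_equiv := EquivRelPack tens_congb_class.
Canonical tens_cong_encModRel := defaultEncModRel tens_congb.

Definition tensor := {eq_quot tens_congb}.
HB.instance Definition _ : EqQuotient _ tens_congb tensor :=
  EqQuotient.on tensor.
HB.instance Definition _ := Choice.on tensor.

Lemma tens_piP (a b : term) : \pi_tensor a = \pi_tensor b <-> tens_cong a b.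
Proof.
split=> [/eqP|ab]; first by rewrite piE => /asboolP.
by apply/eqP; rewrite piE; apply/asboolP.
Qed.

Lemma tens_reprP (a : term) : tens_cong (repr (\pi_tensor a)) a.
Proof. by apply/tens_piP; rewrite reprK. Qed.

Lemma tens_pi_ind (P : tensor -> Prop) :
  (forall a, P (\pi_tensor a)) -> forall u, P u.
Proof. by move=> h u; rewrite -(reprK u). Qed.

Definition tens_opp (u : tensor) : tensor := \pi_tensor (TNeg (repr u)).
Definition tens_add (u v : tensor) : tensor :=
  \pi_tensor (TSum (repr u) (repr v)).
Definition tens_scale (r : R) (u : tensor) : tensor :=
  \pi_tensor (TScale r (repr u)).

Lemma tens_pi_opp a : tens_opp (\pi_tensor a) = \pi_tensor (TNeg a).
Proof. by apply/tens_piP/tc_opp/tens_reprP. Qed.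
Lemma tens_pi_add a b :
  tens_add (\pi_tensor a) (\pi_tensor b) = \pi_tensor (TSum a b).
Proof. by apply/tens_piP/tc_add; exact: tens_reprP. Qed.
Lemma tens_pi_scale r a : tens_scale r (\pi_tensor a) = \pi_tensor (TScale r a).
Proof. by apply/tens_piP/tc_scale; exact: tens_reprP. Qed.

Let piE' := (tens_pi_opp, tens_pi_add, tens_pi_scale).

Lemma tens_addA : associative tens_add.
Proof.
elim/tens_pi_ind=> a; elim/tens_pi_ind=> b; elim/tens_pi_ind=> c.
by rewrite !piE'; apply/tens_piP/tc_addA.
Qed.
Lemma tens_addC : commutative tens_add.
Proof.
elim/tens_pi_ind=> a; elim/tens_pi_ind=> b.
by rewrite !piE'; apply/tens_piP/tc_addC.
Qed.
Lemma tens_add0 : left_id (\pi_tensor TZero) tens_add.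
Proof. by elim/tens_pi_ind=> a; rewrite !piE'; apply/tens_piP/tc_add0. Qed.
Lemma tens_addN : left_inverse (\pi_tensor TZero) tens_opp tens_add.
Proof. by elim/tens_pi_ind=> a; rewrite !piE'; apply/tens_piP/tc_addN. Qed.

HB.instance Definition _ :=
  GRing.isZmodule.Build tensor tens_addA tens_addC tens_add0 tens_addN.

Lemma tens_scaleA r s v : tens_scale r (tens_scale s v) = tens_scale (r * s) v.
Proof.
by elim/tens_pi_ind: v => a; rewrite !piE'; apply/tens_piP/tc_scaleA.
Qed.
Lemma tens_scale1 : left_id 1 tens_scale.
Proof. by elim/tens_pi_ind=> a; rewrite !piE'; apply/tens_piP/tc_scale1. Qed.
Lemma tens_scaleDr : right_distributive tens_scale +%R.
Proof.
move=> r; elim/tens_pi_ind=> a; elim/tens_pi_ind=> b.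
by rewrite /GRing.add /= !piE'; apply/tens_piP/tc_scaleDr.
Qed.
Lemma tens_scaleDl v : {morph tens_scale^~ v : r s / r + s}.
Proof.
move=> r s; elim/tens_pi_ind: v => a.
by rewrite [in RHS]/GRing.add /= !piE'; apply/tens_piP/tc_scaleDl.
Qed.

HB.instance Definition _ := GRing.Zmodule_isLmodule.Build R tensor
  tens_scaleA tens_scale1 tens_scaleDr tens_scaleDl.

Definition tens (u : U) (v : V) : tensor := \pi_tensor (TPure u v).

Lemma tensDl u u' v : tens (u + u') v = tens u v + tens u' v.
Proof. by rewrite [RHS]tens_pi_add; apply/tens_piP/tc_pureDl. Qed.
Lemma tensDr u v v' : tens u (v + v') = tens u v + tens u v'.
Proof. by rewrite [RHS]tens_pi_add; apply/tens_piP/tc_pureDr. Qed.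
Lemma tensZl r u v : tens (r *: u) v = r *: tens u v.
Proof. by rewrite [RHS]tens_pi_scale; apply/tens_piP/tc_pureZl. Qed.
Lemma tensZr r u v : tens u (r *: v) = r *: tens u v.
Proof. by rewrite [RHS]tens_pi_scale; apply/tens_piP/tc_pureZr. Qed.

Lemma tens_ind (P : tensor -> Prop) :
  P 0 -> (forall u v, P (tens u v)) -> (forall z, P z -> P (- z)) ->
  (forall z z', P z -> P z' -> P (z + z')) ->
  (forall r z, P z -> P (r *: z)) -> forall z, P z.
Proof.
move=> P0 Pt PN PD PZ; elim/tens_pi_ind; elim=> //.
- by move=> a /PN; rewrite [- _]tens_pi_opp.
- by move=> a Pa b Pb; have := PD _ _ Pa Pb; rewrite [_ + _]tens_pi_add.
- by move=> r a /(PZ r); rewrite [_ *: _]tens_pi_scale.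
Qed.

(* u (x) v |-> f u (x) g v, for f and g semilinear along s *)
Section SemilinearMap.
Variables (s : {rmorphism R -> R}) (f : U -> U) (g : V -> V).
Hypothesis fD : {morph f : u v / u + v}.
Hypothesis gD : {morph g : u v / u + v}.
Hypothesis fZ : forall r u, f (r *: u) = s r *: f u.
Hypothesis gZ : forall r v, g (r *: v) = s r *: g v.

Fixpoint tens_map_term (a : term) : term :=
  match a with
  | TZero => TZero
  | TPure u v => TPure (f u) (g v)
  | TNeg a => TNeg (tens_map_term a)
  | TSum a b => TSum (tens_map_term a) (tens_map_term b)
  | TScale r a => TScale (s r) (tens_map_term a)
  end.

Definition tens_map (z : tensor) : tensor := \pi_tensor (tens_map_term (repr z)).

Lemma tens_map_term_cong a b :
  tens_cong a b -> tens_cong (tens_map_term a) (tens_map_term b).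
Proof.
by elim=> {a b} /=;
  do ?[by intros; rewrite ?rmorphM ?rmorphD ?rmorph1 ?fD ?gD ?fZ ?gZ;
       eauto using tens_cong].
Qed.

Lemma tens_map_pi a : tens_map (\pi_tensor a) = \pi_tensor (tens_map_term a).
Proof. by apply/tens_piP/tens_map_term_cong/tens_reprP. Qed.

Lemma tens_map_tens u v : tens_map (tens u v) = tens (f u) (g v).
Proof. exact: tens_map_pi. Qed.

Lemma tens_mapD : {morph tens_map : y z / y + z}.
Proof.
elim/tens_pi_ind=> a; elim/tens_pi_ind=> b.
by rewrite /GRing.add /= tens_pi_add !tens_map_pi /= tens_pi_add.
Qed.

Lemma tens_mapZ r z : tens_map (r *: z) = s r *: tens_map z.
Proof.
elim/tens_pi_ind: z => a.
by rewrite /GRing.scale /= tens_pi_scale !tens_map_pi /= tens_pi_scale.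
Qed.

Lemma tens_map0 : tens_map 0 = 0.
Proof. exact: tens_map_pi. Qed.

Lemma tens_mapN z : tens_map (- z) = - tens_map z.
Proof. by apply/eqP; rewrite -addr_eq0 -tens_mapD addNr tens_map0. Qed.

End SemilinearMap.

End Tensor.

Section GWATensor.
Variables (R : comNzRingType) (sigma : ringAut R) (t t' : R).
Variables (M : lmodType (gwa sigma t)) (M' : lmodType (gwa sigma t')).

Local Notation T := (tensor (gwa_res M) (gwa_res M')).

Definition res_op (s : R) (N : lmodType (gwa sigma s)) (u : gwa sigma s)
  (v : gwa_res N) : gwa_res N := u *: (v : N).

Lemma res_opD s N u : {morph @res_op s N u : v w / v + w}.
Proof. by move=> v w; rewrite /res_op scalerDr. Qed.

Lemma res_opXZ s N r v :
  @res_op s N (gwaX sigma s) (r *: v) = sigma r *: res_op (gwaX sigma s) v.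
Proof.
change (gwaX sigma s *: (gwaC sigma s r *: (v : N)) =
  gwaC sigma s (sigma r) *: (gwaX sigma s *: (v : N))).
by rewrite !scalerA gwaXC.
Qed.

Lemma res_opYZ s N r v :
  @res_op s N (gwaY sigma s) (r *: v) =
  aut_inv sigma r *: res_op (gwaY sigma s) v.
Proof.
change (gwaY sigma s *: (gwaC sigma s r *: (v : N)) =
  gwaC sigma s (aut_inv sigma r) *: (gwaY sigma s *: (v : N))).
by rewrite !scalerA gwaYC.
Qed.

Lemma res_opYX s N v :
  @res_op s N (gwaY sigma s) (res_op (gwaX sigma s) v) = s *: v.
Proof. by rewrite /res_op scalerA gwaYX. Qed.

Lemma res_opXY s N v :
  @res_op s N (gwaX sigma s) (res_op (gwaY sigma s) v) = sigma s *: v.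
Proof. by rewrite /res_op scalerA gwaXY. Qed.

Definition tensX : T -> T :=
  tens_map sigma (@res_op _ M (gwaX sigma t)) (@res_op _ M' (gwaX sigma t')).
Definition tensY : T -> T :=
  tens_map (aut_inv sigma)
    (@res_op _ M (gwaY sigma t)) (@res_op _ M' (gwaY sigma t')).

Lemma tensX_tens v v' :
  tensX (tens v v') = tens (res_op (gwaX sigma t) v) (res_op (gwaX sigma t') v').
Proof.
by apply: tens_map_tens; [exact: res_opD|exact: res_opD|exact: res_opXZ|
  exact: res_opXZ].
Qed.

Lemma tensY_tens v v' :
  tensY (tens v v') = tens (res_op (gwaY sigma t) v) (res_op (gwaY sigma t') v').
Proof.
by apply: tens_map_tens; [exact: res_opD|exact: res_opD|exact: res_opYZ|
  exact: res_opYZ].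
Qed.

Lemma tensXD : {morph tensX : u v / u + v}.
Proof.
by apply: tens_mapD; [exact: res_opD|exact: res_opD|exact: res_opXZ|
  exact: res_opXZ].
Qed.

Lemma tensYD : {morph tensY : u v / u + v}.
Proof.
by apply: tens_mapD; [exact: res_opD|exact: res_opD|exact: res_opYZ|
  exact: res_opYZ].
Qed.

Lemma tensXZ r v : tensX (r *: v) = sigma r *: tensX v.
Proof.
by apply: tens_mapZ; [exact: res_opD|exact: res_opD|exact: res_opXZ|
  exact: res_opXZ].
Qed.

Lemma tensYZ r v : tensY (r *: v) = aut_inv sigma r *: tensY v.
Proof.
by apply: tens_mapZ; [exact: res_opD|exact: res_opD|exact: res_opYZ|
  exact: res_opYZ].
Qed.

Lemma tensX0 : tensX 0 = 0.
Proof. by apply: (addrI (tensX 0)); rewrite -tensXD !addr0. Qed.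
Lemma tensY0 : tensY 0 = 0.
Proof. by apply: (addrI (tensY 0)); rewrite -tensYD !addr0. Qed.
Lemma tensXN v : tensX (- v) = - tensX v.
Proof. by apply/eqP; rewrite -addr_eq0 -tensXD addNr tensX0. Qed.
Lemma tensYN v : tensY (- v) = - tensY v.
Proof. by apply/eqP; rewrite -addr_eq0 -tensYD addNr tensY0. Qed.

Lemma tensYX v : tensY (tensX v) = (t * t') *: v.
Proof.
elim/tens_ind: v => [|u v|z e|y z ey ez|r z e].
- by rewrite tensX0 tensY0 scaler0.
- by rewrite tensX_tens tensY_tens !res_opYX tensZl tensZr scalerA.
- by rewrite tensXN tensYN e scalerN.
- by rewrite tensXD tensYD ey ez scalerDr.
- by rewrite tensXZ tensYZ e aut_funK !scalerA mulrC.
Qed.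

Lemma tensXY v : tensX (tensY v) = sigma (t * t') *: v.
Proof.
elim/tens_ind: v => [|u v|z e|y z ey ez|r z e].
- by rewrite tensY0 tensX0 scaler0.
- by rewrite tensY_tens tensX_tens !res_opXY tensZl tensZr scalerA rmorphM.
- by rewrite tensYN tensXN e scalerN.
- by rewrite tensYD tensXD ey ez scalerDr.
- by rewrite tensYZ tensXZ e aut_invK !scalerA mulrC.
Qed.

(* M (x)_R M' is an A(t t')-module; the explicit proof of s = t t' makes it an
   A(s)-module, so that A(1 t) can be read as A(t). *)
Variables (s : R) (def_s : s = t * t').

Fact tensYX_eq v : tensY (tensX v) = s *: v.
Proof. by rewrite def_s tensYX. Qed.
Fact tensXY_eq v : tensX (tensY v) = sigma s *: v.
Proof. by rewrite def_s tensXY. Qed.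

Definition tens_rep : gwa_rep sigma s :=
  GwaRep tensXD tensYD tensXZ tensYZ tensYX_eq tensXY_eq.

Definition gwa_tensor : lmodType (gwa sigma s) := gwa_mod tens_rep.

End GWATensor.

(* An idealr is a proper ideal given by a boolean predicate; as the logic is
   classical here, this is no restriction on ideals. *)
Definition maximal_ideal (R : comNzRingType) (I : idealr R) : Prop :=
  forall J : idealr R, {subset I <= J} -> J =i I.

Record maxSpec (R : comNzRingType) := MaxSpec {
  max_ideal :> idealr R;
  max_idealP : maximal_ideal max_ideal
}.

Section ResidueField.
Variables (R : comNzRingType) (m : maxSpec R).

Definition residue : Type := {ideal_quot m}.
HB.instance Definition _ := GRing.ComNzRing.on residue.
HB.instance Definition _ := EqQuotient.on residue.

Definition toRes (x : R) : residue := \pi_({ideal_quot m}) x.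

Lemma toRes_zmod_morphism : zmod_morphism toRes.
Proof. exact: rmorphB. Qed.
Lemma toRes_monoid_morphism : monoid_morphism toRes.
Proof. by split=> [|x y]; rewrite /toRes ?rmorph1 ?rmorphM. Qed.
HB.instance Definition _ :=
  GRing.isZmodMorphism.Build R residue toRes toRes_zmod_morphism.
HB.instance Definition _ :=
  GRing.isMonoidMorphism.Build R residue toRes toRes_monoid_morphism.

Definition ofRes (a : residue) : R := repr (a : {ideal_quot m}).

Lemma ofResK : cancel ofRes toRes.
Proof. by move=> a; rewrite /toRes /ofRes reprK. Qed.

Lemma toRes_eq0 x : (toRes x == 0) = (x \in m).
Proof.
rewrite -(rmorph0 toRes) /toRes -Quotient.idealrBE subr0.
by [].
Qed.

Lemma residue_has_inv (a : residue) : a != 0 -> exists b, b * a == 1.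
Proof.
rewrite -(ofResK a) toRes_eq0; move: (ofRes a) => x xm.
pose J : R -> bool := fun b => `[< exists u, b - u * x \in m >].
have [J1|J1] := boolP (1 \in J).
  case/asboolP: J1 => u um; exists (toRes u).
  by rewrite -rmorphM -(rmorph1 toRes) eq_sym -subr_eq0 -rmorphB toRes_eq0.
have Jid : idealr_closed J.
  split=> //; first by apply/asboolP; exists 0; rewrite mul0r subr0 idealr0.
  move=> c b b' /asboolP[u ub] /asboolP[u' ub']; apply/asboolP.
  exists (c * u + u').
  have -> : c * b + b' - (c * u + u') * x = c * (b - u * x) + (b' - u' * x).
    by rewrite mulrDl mulrBr mulrA opprD addrACA.
  by rewrite rpredD // idealMr.
pose JI : idealr R := HB.pack J (isIdealr.Build R J Jid).
have mJ : {subset m <= JI}.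
  by move=> b bm; apply/asboolP; exists 0; rewrite mul0r subr0.
case/negP: xm; rewrite -(max_idealP mJ).
by apply/asboolP; exists 1; rewrite mul1r subrr idealr0.
Qed.

Definition residue_inv (a : residue) : residue :=
  if pselect (exists b, b * a == 1) is left h then xchoose h else 0.

Lemma residue_mulVf a : a != 0 -> residue_inv a * a = 1.
Proof.
move=> /residue_has_inv h; rewrite /residue_inv.
by case: pselect => // h'; apply/eqP/(xchooseP h').
Qed.
Lemma residue_inv0 : residue_inv 0 = 0.
Proof.
rewrite /residue_inv; case: pselect => // h; exfalso.
by case: h => b; rewrite mulr0 eq_sym oner_eq0.
Qed.

HB.instance Definition _ :=
  GRing.ComNzRing_isField.Build residue residue_mulVf residue_inv0.

Definition residue_scale (r : R) (a : residue) : residue := toRes r * a.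

Fact residue_scaleA r s v :
  residue_scale r (residue_scale s v) = residue_scale (r * s) v.
Proof. by rewrite /residue_scale rmorphM mulrA. Qed.
Fact residue_scale1 : left_id 1 residue_scale.
Proof. by move=> v; rewrite /residue_scale rmorph1 mul1r. Qed.
Fact residue_scaleDr : right_distributive residue_scale +%R.
Proof. by move=> r u v; rewrite /residue_scale mulrDr. Qed.
Fact residue_scaleDl v : {morph residue_scale^~ v : r s / r + s}.
Proof. by move=> r s; rewrite /residue_scale rmorphD mulrDl. Qed.

HB.instance Definition _ := GRing.Zmodule_isLmodule.Build R residue
  residue_scaleA residue_scale1 residue_scaleDr residue_scaleDl.

Lemma residueZE (r : R) (a : residue) : r *: a = toRes r * a.
Proof. by []. Qed.

End ResidueField.

(* The map R/m -> R/m' induced by f, meaningful when f(m) is included in m'.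
   Since it is defined on representatives, no equation between ideals is
   needed to state it; with f the identity it identifies R/m with R/m' when
   m and m' are equal, e.g. for m' = sigma^{rp}(m). *)
Definition res_map (R : comNzRingType) (f : R -> R) (m m' : maxSpec R)
  (a : residue m) : residue m' := toRes m' (f (ofRes a)).
Arguments res_map {R} f {m m'} a.

Section MaxSpecAction.
Variables (R : comNzRingType) (sigma : ringAut R).

Definition aut_pred (m : R -> bool) : R -> bool := fun x => m (aut_inv sigma x).

Lemma aut_idealr_closed (m : idealr R) : idealr_closed (aut_pred m).
Proof.
split; rewrite ?unfold_in /aut_pred.
- by rewrite rmorph0; exact: idealr0.
- by rewrite rmorph1; apply/negbT; exact: idealr1.
- move=> a u v; rewrite !unfold_in rmorphD rmorphM => um vm.
  by apply: rpredD; first exact: idealMr.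
Qed.

HB.instance Definition _ (m : idealr R) :=
  isIdealr.Build R (aut_pred m) (aut_idealr_closed m).

Definition inv_aut_pred (m : R -> bool) : R -> bool := fun x => m (sigma x).

Lemma inv_aut_idealr_closed (m : idealr R) : idealr_closed (inv_aut_pred m).
Proof.
split; rewrite ?unfold_in /inv_aut_pred.
- by rewrite rmorph0; exact: idealr0.
- by rewrite rmorph1; apply/negbT; exact: idealr1.
- move=> a u v; rewrite !unfold_in rmorphD rmorphM => um vm.
  by apply: rpredD; first exact: idealMr.
Qed.

HB.instance Definition _ (m : idealr R) :=
  isIdealr.Build R (inv_aut_pred m) (inv_aut_idealr_closed m).

Lemma aut_maximal (m : maxSpec R) :
  maximal_ideal (aut_pred (max_ideal m) : idealr R).
Proof.
move=> J mJ x; rewrite -[x in LHS](@aut_invK _ sigma) [RHS]unfold_in.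
have := @max_idealP _ m (inv_aut_pred J : idealr R); apply.
move=> y ym; rewrite unfold_in; apply: mJ.
by rewrite unfold_in /= /aut_pred aut_funK.
Qed.

Definition aut_max (m : maxSpec R) : maxSpec R := MaxSpec (@aut_maximal m).

Lemma mem_aut_max m x : (x \in aut_max m) = (aut_inv sigma x \in m).
Proof. by []. Qed.

Definition aut_iter (k : nat) (m : maxSpec R) : maxSpec R := iter k aut_max m.

Lemma mem_aut_iter k m x : (iter k sigma x \in aut_iter k m) = (x \in m).
Proof. by rewrite /aut_iter; elim: k => //= k ih; rewrite mem_aut_max aut_funK. Qed.

(* The orbit of m0 under the group generated by sigma. *)
Definition orbit_of (m0 : maxSpec R) : set (maxSpec R) :=
  [set m | exists k, m = aut_iter k m0 \/ m0 = aut_iter k m]%classic.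

(* B^t_omega *)
Definition breaks (m0 : maxSpec R) (t : R) : set (maxSpec R) :=
  [set m | orbit_of m0 m /\ t \in m]%classic.

End MaxSpecAction.
Arguments aut_iter {R} sigma k m : simpl never.

Section DirectSum.
Variables (R : pzRingType) (I : finType) (T : I -> lmodType R).

Definition dsum : Type := {dffun forall i, T i}.
HB.instance Definition _ := Choice.on dsum.

Definition dsum_coord (v : dsum) (i : I) : T i :=
  (v : {dffun forall i, T i}) i.
Definition dsum_of (f : forall i, T i) : dsum :=
  ([ffun i => f i] : {dffun forall i, T i}).

Lemma dsum_ofE f i : dsum_coord (dsum_of f) i = f i.
Proof. by rewrite /dsum_coord /dsum_of ffunE. Qed.

Lemma dsumP (u v : dsum) : (forall i, dsum_coord u i = dsum_coord v i) -> u = v.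
Proof. by move=> uv; apply/ffunP => i; exact: uv. Qed.

Definition dsum_zero : dsum := dsum_of (fun=> 0).
Definition dsum_opp (u : dsum) : dsum := dsum_of (fun i => - dsum_coord u i).
Definition dsum_add (u v : dsum) : dsum :=
  dsum_of (fun i => dsum_coord u i + dsum_coord v i).
Definition dsum_scale (r : R) (u : dsum) : dsum :=
  dsum_of (fun i => r *: dsum_coord u i).

Fact dsum_addA : associative dsum_add.
Proof. by move=> u v w; apply: dsumP => i; rewrite !dsum_ofE addrA. Qed.
Fact dsum_addC : commutative dsum_add.
Proof. by move=> u v; apply: dsumP => i; rewrite !dsum_ofE addrC. Qed.
Fact dsum_add0 : left_id dsum_zero dsum_add.
Proof. by move=> u; apply: dsumP => i; rewrite !dsum_ofE add0r. Qed.
Fact dsum_addN : left_inverse dsum_zero dsum_opp dsum_add.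
Proof. by move=> u; apply: dsumP => i; rewrite !dsum_ofE addNr. Qed.

HB.instance Definition _ :=
  GRing.isZmodule.Build dsum dsum_addA dsum_addC dsum_add0 dsum_addN.

Fact dsum_scaleA r s v : dsum_scale r (dsum_scale s v) = dsum_scale (r * s) v.
Proof. by apply: dsumP => i; rewrite !dsum_ofE scalerA. Qed.
Fact dsum_scale1 : left_id 1 dsum_scale.
Proof. by move=> v; apply: dsumP => i; rewrite !dsum_ofE scale1r. Qed.
Fact dsum_scaleDr : right_distributive dsum_scale +%R.
Proof. by move=> r u v; apply: dsumP => i; rewrite !dsum_ofE scalerDr. Qed.
Fact dsum_scaleDl v : {morph dsum_scale^~ v : r s / r + s}.
Proof. by move=> r s; apply: dsumP => i; rewrite !dsum_ofE scalerDl. Qed.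

HB.instance Definition _ := GRing.Zmodule_isLmodule.Build R dsum
  dsum_scaleA dsum_scale1 dsum_scaleDr dsum_scaleDl.

Definition dsum_inj (i : I) (a : T i) : dsum := dsum_of (@dfwith I T (fun=> 0) i a).
Arguments dsum_inj : clear implicits.

Lemma dsum_coord0 i : dsum_coord 0 i = 0.
Proof. exact: dsum_ofE. Qed.
Lemma dsum_coordD u v i :
  dsum_coord (u + v) i = dsum_coord u i + dsum_coord v i.
Proof. exact: dsum_ofE. Qed.
Lemma dsum_coordZ r v i : dsum_coord (r *: v) i = r *: dsum_coord v i.
Proof. exact: dsum_ofE. Qed.
Lemma dsum_coord_sum (J : Type) (s : seq J) (P : pred J) (F : J -> dsum) i :
  dsum_coord (\sum_(j <- s | P j) F j) i =
  \sum_(j <- s | P j) dsum_coord (F j) i.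
Proof.
by apply: (big_morph (dsum_coord^~ i)) => [u v|];
  rewrite ?dsum_coordD ?dsum_coord0.
Qed.

Lemma dsum_coord_inj i a : dsum_coord (dsum_inj i a) i = a.
Proof. by rewrite dsum_ofE dfwith_in. Qed.
Lemma dsum_coord_inj_out i a j : i != j -> dsum_coord (dsum_inj i a) j = 0.
Proof. by move=> ij; rewrite dsum_ofE dfwith_out. Qed.

Lemma dsum_injD i : {morph dsum_inj i : a b / a + b}.
Proof.
move=> a b; apply: dsumP => j; rewrite dsum_coordD.
have [<-|ij] := eqVneq i j; first by rewrite !dsum_coord_inj.
by rewrite !dsum_coord_inj_out // addr0.
Qed.

Lemma dsum_inj0 i : dsum_inj i 0 = 0.
Proof. by apply: (addrI (dsum_inj i 0)); rewrite -dsum_injD !addr0. Qed.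

Lemma dsum_injZ i r a : dsum_inj i (r *: a) = r *: dsum_inj i a.
Proof.
apply: dsumP => j; rewrite dsum_coordZ.
have [<-|ij] := eqVneq i j; first by rewrite !dsum_coord_inj.
by rewrite !dsum_coord_inj_out // scaler0.
Qed.

Lemma dsum_inj_sum i (J : Type) (s : seq J) (P : pred J) (F : J -> T i) :
  dsum_inj i (\sum_(j <- s | P j) F j) = \sum_(j <- s | P j) dsum_inj i (F j).
Proof. exact: (big_morph _ (@dsum_injD i) (dsum_inj0 i)). Qed.

Lemma dsumE v : v = \sum_i dsum_inj i (dsum_coord v i).
Proof.
apply: dsumP => i; rewrite dsum_coord_sum (bigD1 i) //= dsum_coord_inj.
by rewrite big1 ?addr0 // => j ji; rewrite dsum_coord_inj_out.
Qed.

End DirectSum.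
Arguments dsum {R I} T.
Arguments dsum_inj {R I} T i a.

Inductive letter := L1 | Lx | Ly | L0.

Section StringModule.
Variables (R : comNzRingType) (sigma : ringAut R) (m0 : maxSpec R).

(* Membership in D^t_omega: the word w_j w_{j+1} ... is given by its first index
   j and the sequence of its letters. *)
Definition in_D (t : R) (j : nat) (w : seq letter) : Prop :=
  forall i, (i < size w)%N ->
    nth L1 w i = L1 <-> ~ breaks sigma m0 t (aut_iter sigma (j + i) m0).

Lemma in_D_ones j n : in_D 1 j (nseq n L1).
Proof.
move=> i; rewrite size_nseq nth_nseq => ->; split=> // _ [_].
by apply/negP/negbT/idealr1.
Qed.

Lemma iter_mul_id p r : (forall x : R, iter p sigma x = x) ->
  forall x : R, iter (r * p) sigma x = x.
Proof. by move=> h x; elim: r => //= r ih; rewrite mulSn iterD ih h. Qed.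

(* Ordinals start at 0: i : 'I_n stands for the index k = i + 1, so the
   letter w_k is tnth w i and e_{k,s} is string_basis i s; ordS and ord_pred are
   the cyclic successor and predecessor on 1, ..., n. *)
Variables (t : R) (n d : nat) (w : n.-tuple letter).
Variable F : 'M[residue m0]_d.

Definition string_comp (ks : 'I_n * 'I_d) : lmodType R :=
  residue (aut_iter sigma ks.1.+1 m0).

Definition string_sum : lmodType R := dsum string_comp.

Definition string_basis (k : 'I_n) (s : 'I_d) : string_sum :=
  dsum_inj string_comp (k, s) 1.

(* f(G) e_{k,s} = \sum_i f(G)_{i,s} e_{k,i}, where f(G) is the image of the
   matrix G over R/m0 under the map R/m0 -> R/sigma^k(m0) induced by f. *)
Definition string_col (f : R -> R) (G : 'M[residue m0]_d) (k : 'I_n) (s : 'I_d) :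
    string_sum :=
  \sum_i dsum_inj string_comp (k, i) (res_map f (G i s)).

Definition string_Xe (k : 'I_n) (s : 'I_d) : string_sum :=
  let e := if k.+1 == n then string_col sigma F (ordS k) s
           else string_basis (ordS k) s in
  match tnth w k with
  | L1 => sigma t *: e
  | Lx => e
  | Ly | L0 => 0
  end.

Definition string_Ye (k : 'I_n) (s : 'I_d) : string_sum :=
  let e := if k == 0%N :> nat then string_col id (invmx F) (ord_pred k) s
           else string_basis (ord_pred k) s in
  match tnth w (ord_pred k) with
  | L1 | Ly => e
  | Lx | L0 => 0
  end.

Definition string_ext (f : R -> R) (E : 'I_n -> 'I_d -> string_sum)
    (v : string_sum) : string_sum :=
  \sum_(ks : 'I_n * 'I_d) f (ofRes (dsum_coord v ks)) *: E ks.1 ks.2.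

Definition string_X := string_ext sigma string_Xe.
Definition string_Y := string_ext (aut_inv sigma) string_Ye.

Hypothesis sigma_n : forall x : R, iter n sigma x = x.
Hypothesis wD : in_D t 1 w.
Hypothesis F_unit : F \in unitmx.

Section Ext.
Variables (f : {rmorphism R -> R}) (E : 'I_n -> 'I_d -> string_sum).
Hypothesis fE : forall (k : 'I_n) (s : 'I_d) r,
  r \in aut_iter sigma k.+1 m0 -> f r *: E k s = 0.

Lemma string_ext_coef (k : 'I_n) s r r' :
  toRes (aut_iter sigma k.+1 m0) r = toRes _ r' -> f r *: E k s = f r' *: E k s.
Proof.
move=> /eqP; rewrite -subr_eq0 -rmorphB toRes_eq0 => /(fE s).
by rewrite rmorphB scalerBl => /eqP; rewrite subr_eq0 => /eqP.
Qed.

Lemma string_extD : {morph string_ext f E : u v / u + v}.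
Proof.
move=> u v; rewrite /string_ext -big_split /=; apply: eq_bigr => -[k s] _ /=.
rewrite -scalerDl -rmorphD; apply: string_ext_coef.
by rewrite rmorphD /= !ofResK dsum_coordD.
Qed.

Lemma string_extZ r v : string_ext f E (r *: v) = f r *: string_ext f E v.
Proof.
rewrite /string_ext scaler_sumr; apply: eq_bigr => -[k s] _ /=.
rewrite scalerA -rmorphM; apply: string_ext_coef.
by rewrite rmorphM /= !ofResK dsum_coordZ.
Qed.

Lemma string_ext0 : string_ext f E 0 = 0.
Proof. by apply: (addrI (string_ext f E 0)); rewrite -string_extD !addr0. Qed.

Lemma string_ext_sum (J : Type) (s : seq J) (P : pred J) G :
  string_ext f E (\sum_(j <- s | P j) G j) =
  \sum_(j <- s | P j) string_ext f E (G j).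
Proof. exact: (big_morph _ string_extD string_ext0). Qed.

Lemma string_ext_inj k s a :
  string_ext f E (dsum_inj string_comp (k, s) a) = f (ofRes a) *: E k s.
Proof.
rewrite /string_ext (bigD1 (k, s)) //= dsum_coord_inj big1 ?addr0 // => -[k' s'].
rewrite eq_sym => kk /=; rewrite dsum_coord_inj_out //.
by rewrite fE // -toRes_eq0 ofResK.
Qed.

Lemma string_ext_basis k s : string_ext f E (string_basis k s) = E k s.
Proof.
rewrite string_ext_inj -[RHS]scale1r -(rmorph1 f); apply: string_ext_coef.
by rewrite ofResK rmorph1.
Qed.

End Ext.

Lemma string_zero (k : 'I_n) (s : 'I_d) r a : r \in aut_iter sigma k.+1 m0 ->
  r *: dsum_inj string_comp (k, s) a = 0.
Proof.
rewrite -toRes_eq0 => /eqP r0.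
by rewrite -dsum_injZ residueZE r0 mul0r dsum_inj0.
Qed.

Lemma mem_aut_iterS j r :
  (sigma r \in aut_iter sigma j.+1 m0) = (r \in aut_iter sigma j m0).
Proof. by rewrite [LHS]mem_aut_max aut_funK. Qed.

Lemma mem_aut_iter_mod j : aut_iter sigma (j %% n) m0 =i aut_iter sigma j m0.
Proof.
move=> x; rewrite [in RHS](divn_eq j n); elim: (_ %/ _)%N => [|q ih] //.
rewrite ih mulSn -addnA -[in RHS](sigma_n x).
by rewrite [aut_iter sigma (n + _) m0]iterD mem_aut_iter.
Qed.

Lemma mem_ordS (k : 'I_n) r :
  (sigma r \in aut_iter sigma (ordS k).+1 m0) = (r \in aut_iter sigma k.+1 m0).
Proof. by rewrite mem_aut_iterS /= mem_aut_iter_mod. Qed.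

Lemma mem_ord_pred (k : 'I_n) r :
  (aut_inv sigma r \in aut_iter sigma (ord_pred k).+1 m0) =
  (r \in aut_iter sigma k.+1 m0).
Proof. by rewrite -mem_ordS aut_invK ord_predK. Qed.

Lemma ordS_last (k : 'I_n) : k.+1 = n -> ordS k = 0%N :> nat.
Proof. by move=> kn; rewrite /= kn modnn. Qed.

Lemma ordS_nlast (k : 'I_n) : k.+1 != n -> ordS k = k.+1 :> nat.
Proof. by move=> kn; rewrite /= modn_small // ltn_neqAle kn /=. Qed.

Lemma eq_toRes (m : maxSpec R) x y : x - y \in m -> toRes m x = toRes m y.
Proof. by rewrite -toRes_eq0 rmorphB subr_eq0 => /eqP. Qed.

Lemma ofRes_mod (m : maxSpec R) x : ofRes (toRes m x) - x \in m.
Proof. by rewrite -toRes_eq0 rmorphB /= ofResK subrr. Qed.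

Section ResMap.
Variables (f : {rmorphism R -> R}) (m m' : maxSpec R).
Hypothesis f_sub : forall x, x \in m -> f x \in m'.

Lemma res_map_toRes x : res_map f (toRes m x) = toRes m' (f x).
Proof. by apply: eq_toRes; rewrite -rmorphB; apply/f_sub/ofRes_mod. Qed.

Lemma res_mapD (a b : residue m) :
  res_map f (a + b) = res_map f a + res_map f b :> residue m'.
Proof.
by rewrite -[a]ofResK -[b]ofResK -rmorphD !res_map_toRes -rmorphD -rmorphD.
Qed.

Lemma res_mapM (a b : residue m) :
  res_map f (a * b) = res_map f a * res_map f b :> residue m'.
Proof.
by rewrite -[a]ofResK -[b]ofResK -rmorphM !res_map_toRes -rmorphM -rmorphM.
Qed.

Lemma res_map1 : res_map f (1 : residue m) = 1 :> residue m'.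
Proof. by rewrite -(rmorph1 (toRes m)) res_map_toRes !rmorph1. Qed.

Lemma res_map0 : res_map f (0 : residue m) = 0 :> residue m'.
Proof. by rewrite -(rmorph0 (toRes m)) res_map_toRes !rmorph0. Qed.

Lemma res_map_sum (J : finType) (G : J -> residue m) :
  res_map f (\sum_j G j) = \sum_j res_map f (G j) :> residue m'.
Proof. exact: (big_morph _ res_mapD res_map0). Qed.

End ResMap.

Lemma string_Xe_zero (k : 'I_n) (s : 'I_d) r :
  r \in aut_iter sigma k.+1 m0 -> sigma r *: string_Xe k s = 0.
Proof.
rewrite -mem_ordS => rk.
suff h : sigma r *: (if k.+1 == n then string_col sigma F (ordS k) s
                     else string_basis (ordS k) s) = 0.
  rewrite /string_Xe; case: (tnth w k); rewrite ?scaler0 //.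
  by rewrite scalerA mulrC -scalerA h scaler0.
case: ifP => _; last exact: string_zero.
by rewrite scaler_sumr big1 // => i _; exact: string_zero.
Qed.

Lemma string_Ye_zero (k : 'I_n) (s : 'I_d) r :
  r \in aut_iter sigma k.+1 m0 -> aut_inv sigma r *: string_Ye k s = 0.
Proof.
rewrite -mem_ord_pred => rk.
suff h : aut_inv sigma r *:
    (if k == 0%N :> nat then string_col id (invmx F) (ord_pred k) s
     else string_basis (ord_pred k) s) = 0.
  by rewrite /string_Ye; case: (tnth w _); rewrite ?scaler0.
case: ifP => _; last exact: string_zero.
by rewrite scaler_sumr big1 // => i _; exact: string_zero.
Qed.

Lemma string_XD : {morph string_X : u v / u + v}.
Proof. exact/string_extD/string_Xe_zero. Qed.
Lemma string_YD : {morph string_Y : u v / u + v}.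
Proof. exact/string_extD/string_Ye_zero. Qed.
Lemma string_X0 : string_X 0 = 0.
Proof. exact/string_ext0/string_Xe_zero. Qed.
Lemma string_Y0 : string_Y 0 = 0.
Proof. exact/string_ext0/string_Ye_zero. Qed.
Lemma string_XZ r v : string_X (r *: v) = sigma r *: string_X v.
Proof. exact/string_extZ/string_Xe_zero. Qed.
Lemma string_YZ r v : string_Y (r *: v) = aut_inv sigma r *: string_Y v.
Proof. exact/string_extZ/string_Ye_zero. Qed.
Lemma string_X_basis k s : string_X (string_basis k s) = string_Xe k s.
Proof. exact/string_ext_basis/string_Xe_zero. Qed.
Lemma string_Y_basis k s : string_Y (string_basis k s) = string_Ye k s.
Proof. exact/string_ext_basis/string_Ye_zero. Qed.
Lemma string_X_inj k s a :
  string_X (dsum_inj string_comp (k, s) a) = sigma (ofRes a) *: string_Xe k s.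
Proof. exact/string_ext_inj/string_Xe_zero. Qed.
Lemma string_Y_inj k s a :
  string_Y (dsum_inj string_comp (k, s) a) =
  aut_inv sigma (ofRes a) *: string_Ye k s.
Proof. exact/string_ext_inj/string_Ye_zero. Qed.

Lemma string_injE (k : 'I_n) (s : 'I_d) a :
  dsum_inj string_comp (k, s) a = ofRes a *: string_basis k s.
Proof. by rewrite -dsum_injZ residueZE mulr1 ofResK. Qed.

Lemma string_linear_ext (f : string_sum -> string_sum) r :
  {morph f : u v / u + v} -> (forall a v, f (a *: v) = a *: f v) ->
  (forall k s, f (string_basis k s) = r *: string_basis k s) ->
  forall v, f v = r *: v.
Proof.
move=> fD fZ fe v.
have f0 : f 0 = 0 by apply: (addrI (f 0)); rewrite -fD !addr0.
rewrite [v]dsumE (big_morph _ fD f0) scaler_sumr; apply: eq_bigr => -[k s] _.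
by rewrite string_injE fZ fe !scalerA mulrC.
Qed.

Lemma letter_break (k : 'I_n) :
  tnth w k <> L1 -> t \in aut_iter sigma k.+1 m0.
Proof.
move=> wk; apply: contra_notT wk => tk.
have := @wD k; rewrite size_tuple => /(_ (ltn_ord k)).
by rewrite (tnth_nth L1) => -[_]; apply => -[_]; exact/negP.
Qed.

Lemma string_col_mul (f g : {rmorphism R -> R}) (G H : 'M[residue m0]_d)
    (k : 'I_n) (s : 'I_d) (c : 'I_d -> R) :
  (forall x, x \in m0 -> f x \in aut_iter sigma k.+1 m0) ->
  (forall i, toRes (aut_iter sigma k.+1 m0) (c i) = res_map f (G i s)) ->
  H *m G = 1%:M ->
  \sum_i c i *: string_col f H k i = string_basis k s.
Proof.
move=> f_sub cG HG; under eq_bigr do rewrite scaler_sumr.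
rewrite exchange_big /=.
under eq_bigr => j _ do under eq_bigr => i _ do
  rewrite -dsum_injZ residueZE cG mulrC -(res_mapM f_sub).
under eq_bigr => j _ do rewrite -dsum_inj_sum -(res_map_sum f_sub).
have HGE j : \sum_i H j i * G i s = (j == s)%:R.
  by have /matrixP/(_ j s) := HG; rewrite !mxE.
rewrite (bigD1 s) //= HGE eqxx (res_map1 f_sub) big1 ?addr0 // => j js.
by rewrite HGE (negPf js) (res_map0 f_sub) dsum_inj0.
Qed.

Lemma string_YX v : string_Y (string_X v) = t *: v.
Proof.
move: v; apply: string_linear_ext => [u v|a v|k s].
- by rewrite string_XD string_YD.
- by rewrite string_XZ string_YZ aut_funK.
rewrite string_X_basis.
pose e := if k.+1 == n then string_col sigma F (ordS k) s
          else string_basis (ordS k) s.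
have Ye : string_Y e = match tnth w k with
    L1 | Ly => string_basis k s | _ => 0 end.
  rewrite /e; case: ifPn => [/eqP kn|kn]; last first.
    rewrite string_Y_basis /string_Ye ordS_nlast //= ordSK.
    by case: (tnth w k).
  rewrite (big_morph _ string_YD string_Y0).
  have k0 : ordS k == 0%N :> nat by rewrite ordS_last.
  under eq_bigr do rewrite string_Y_inj /string_Ye k0 ordSK.
  case: (tnth w k); try by rewrite big1 // => i _; rewrite scaler0.
    apply: (@string_col_mul idfun idfun F (invmx F)) => [x xm|i|].
    - by rewrite kn -[x](sigma_n x) mem_aut_iter.
    - apply: eq_toRes; rewrite -mem_ordS rmorphB aut_invK; exact: ofRes_mod.
    - exact: mulVmx.
  apply: (@string_col_mul idfun idfun F (invmx F)) => [x xm|i|].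
  - by rewrite kn -[x](sigma_n x) mem_aut_iter.
  - apply: eq_toRes; rewrite -mem_ordS rmorphB aut_invK; exact: ofRes_mod.
  - exact: mulVmx.
have t0 : tnth w k <> L1 -> t *: string_basis k s = 0.
  by move=> /letter_break; exact: string_zero.
move: Ye t0; rewrite /string_Xe -/e; case: (tnth w k) => Ye t0.
- by rewrite string_YZ Ye aut_funK.
- by rewrite Ye t0.
- by rewrite ?string_Y0 t0.
- by rewrite ?string_Y0 t0.
Qed.

Lemma string_XY v : string_X (string_Y v) = sigma t *: v.
Proof.
move: v; apply: string_linear_ext => [u v|a v|k s].
- by rewrite string_YD string_XD.
- by rewrite string_YZ string_XZ aut_invK.
rewrite string_Y_basis.
pose e := if k == 0%N :> nat then string_col id (invmx F) (ord_pred k) s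
          else string_basis (ord_pred k) s.
have k0E : (k == 0%N :> nat) = ((ord_pred k).+1 == n).
  have kE : k = ordS (ord_pred k) :> nat by rewrite ord_predK.
  rewrite kE; have [pn|pn] := eqVneq (ord_pred k).+1 n.
    by rewrite ordS_last.
  by rewrite ordS_nlast.
have Xe : string_X e = match tnth w (ord_pred k) with
    L1 => sigma t *: string_basis k s | Lx => string_basis k s | _ => 0 end.
  rewrite /e; case: ifPn => [k0|k0]; last first.
    by rewrite string_X_basis /string_Xe ord_predK -k0E (negPf k0).
  rewrite (big_morph _ string_XD string_X0).
  under eq_bigr do rewrite string_X_inj /string_Xe ord_predK -k0E k0.
  have h : \sum_i sigma (ofRes (res_map id (invmx F i s)
      : string_comp (ord_pred k, i))) *: string_col sigma F k i =
      string_basis k s.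
    apply: (@string_col_mul sigma sigma (invmx F) F) => [x xm|i|].
    - by rewrite (eqP k0) mem_aut_iterS.
    - apply: eq_toRes; rewrite -rmorphB -mem_ord_pred aut_funK.
      exact: ofRes_mod.
    - exact: mulmxV.
  case: (tnth w _); rewrite ?h //; try by rewrite big1 // => i _; rewrite scaler0.
  rewrite -{}h scaler_sumr; apply: eq_bigr => i _.
  by rewrite !scalerA mulrC.
have t0 : tnth w (ord_pred k) <> L1 -> sigma t *: string_basis k s = 0.
  move=> /letter_break; rewrite -mem_ordS ord_predK; exact: string_zero.
move: Xe t0; rewrite /string_Ye -/e; case: (tnth w _) => Xe t0.
- by rewrite Xe.
- by rewrite string_X0 t0.
- by rewrite Xe t0.
- by rewrite string_X0 t0.
Qed.

Definition string_rep : gwa_rep sigma t :=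
  GwaRep string_XD string_YD string_XZ string_YZ string_YX string_XY.

(* V^t(omega, w, F); the length n of w is a multiple of p in applications, and
   sigma_n is then a consequence of sigma^p = id. *)
Definition string_mod : lmodType (gwa sigma t) := gwa_mod string_rep.

End StringModule.

Lemma unitmx_exp (K : comUnitRingType) (d : nat) (A : 'M[K]_d) (r : nat) :
  A \in unitmx -> A ^+ r \in unitmx.
Proof.
move=> A_unit; elim: r => [|r ih]; first by rewrite expr0 unitmx1.
by rewrite exprS unitmx_mul A_unit ih.
Qed.

(* Main.v *)
(* Number the blocks from 0 and transport the k-th block of V^t(omega, w, F) to
   (R/m_0)^d by sigma^-(k+1).  Then X becomes a cyclic shift of n columns
   multiplied by scalars depending only on w and t, and by F at the end of the
   word; Y is the reverse shift with F^-1.  Since the p ideals of omega are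
   pairwise comaximal, block l of V^1 and block k of V^t only contribute to the
   tensor product when l = k mod p, and then they contribute a copy of
   (R/m_0)^d.  So both sides consist of rp such columns, the left one being
   multiplied by F at the end of each turn of length p and the right one by F^r
   once; multiplying the k-th column by F^(r - 1 - floor(k/p)) intertwines the
   two. *)
Require Import Defs.
From HB Require Import structures.
From mathcomp Require Import all_boot all_order all_algebra.
From mathcomp Require Import boolp classical_sets functions cardinality.

Set Implicit Arguments.
Unset Strict Implicit.
Unset Printing Implicit Defensive.

Import GRing.Theory.
Local Open Scope ring_scope.

(** * The universal property of the tensor product *)

Section TensorLift.
Variables (R : comNzRingType) (U V W : lmodType R) (f : U -> V -> W).
Hypothesis fDl : forall u u' v, f (u + u') v = f u v + f u' v.
Hypothesis fDr : forall u v v', f u (v + v') = f u v + f u v'.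
Hypothesis fZl : forall r u v, f (r *: u) v = r *: f u v.
Hypothesis fZr : forall r u v, f u (r *: v) = r *: f u v.

Fixpoint tens_lift_term (a : tens_term R U V) : W :=
  match a with
  | TZero => 0
  | TPure u v => f u v
  | TNeg a => - tens_lift_term a
  | TSum a b => tens_lift_term a + tens_lift_term b
  | TScale r a => r *: tens_lift_term a
  end.

Lemma tens_lift_term_cong a b :
  tens_cong a b -> tens_lift_term a = tens_lift_term b.
Proof.
elim=> {a b} //=.
- by move=> a b c _ -> _ ->.
- by move=> a b _ ->.
- by move=> a b c d _ -> _ ->.
- by move=> r a b _ ->.
- by move=> a b c; rewrite addrA.
- by move=> a b; rewrite addrC.
- by move=> a; rewrite add0r.
- by move=> a; rewrite addNr.
- by move=> r s a; rewrite scalerA.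
- by move=> a; rewrite scale1r.
- by move=> r a b; rewrite scalerDr.
- by move=> r s a; rewrite scalerDl.
Qed.

Definition tens_lift (z : tensor U V) : W := tens_lift_term (repr z).

Lemma tens_lift_pi a : tens_lift (\pi_(tensor U V)%qT a) = tens_lift_term a.
Proof. by apply: tens_lift_term_cong; exact: tens_reprP. Qed.

Lemma tens_lift_tens u v : tens_lift (tens u v) = f u v.
Proof. exact: tens_lift_pi. Qed.

Lemma tens_liftD : {morph tens_lift : y z / y + z}.
Proof.
elim/tens_pi_ind=> a; elim/tens_pi_ind=> b.
by rewrite {1}/GRing.add /= tens_pi_add !tens_lift_pi.
Qed.

Lemma tens_liftZ r z : tens_lift (r *: z) = r *: tens_lift z.
Proof.
elim/tens_pi_ind: z => a.
by rewrite {1}/GRing.scale /= tens_pi_scale !tens_lift_pi.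
Qed.

End TensorLift.

(** * Vanishing and comparison principles for tensors *)

Section TensorTheory.
Variables (R : comNzRingType) (U V : lmodType R).

Lemma tens0l (v : V) : tens (0 : U) v = 0.
Proof. by rewrite -(scale0r 0) tensZl scale0r. Qed.
Lemma tens0r (u : U) : tens u (0 : V) = 0.
Proof. by rewrite -(scale0r 0) tensZr scale0r. Qed.

Lemma tens_suml (J : Type) (s : seq J) (P : pred J) (G : J -> U) (v : V) :
  tens (\sum_(j <- s | P j) G j) v = \sum_(j <- s | P j) tens (G j) v.
Proof.
apply: (big_morph (fun u => tens u v)) => [a b|]; first exact: tensDl.
exact: tens0l.
Qed.

Lemma tens_sumr (J : Type) (s : seq J) (P : pred J) (G : J -> V) (u : U) :
  tens u (\sum_(j <- s | P j) G j) = \sum_(j <- s | P j) tens u (G j).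
Proof.
apply: (big_morph (tens u)) => [a b|]; first exact: tensDr.
exact: tens0r.
Qed.

(** Write [1 = a + b], then move [a] to the left factor and [b] to the right one. This kills the
    products of blocks that lie over different maximal ideals. *)
Lemma tens_coprime_annihilators (a b : R) (u : U) (v : V) :
  a + b = 1 -> a *: u = 0 -> b *: v = 0 -> tens u v = 0.
Proof.
move=> ab au bv; rewrite -[tens u v]scale1r -ab scalerDl -tensZl au.
by rewrite -tensZr bv tens0l tens0r addr0.
Qed.

(** The action [s] is left arbitrary so that maps semilinear along [sigma] or its inverse, such as
    those built from X and Y, are covered besides the linear ones. *)
Lemma tens_ext (W : zmodType) (s : R -> W -> W) (g h : tensor U V -> W) :
  {morph g : y z / y + z} -> {morph h : y z / y + z} ->
  (forall r z, g (r *: z) = s r (g z)) -> (forall r z, h (r *: z) = s r (h z)) ->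
  (forall u v, g (tens u v) = h (tens u v)) -> g =1 h.
Proof.
move=> gD hD gZ hZ gh.
have g0 : g 0 = 0 by apply: (addrI (g 0)); rewrite -gD !addr0.
have h0 : h 0 = 0 by apply: (addrI (h 0)); rewrite -hD !addr0.
elim/tens_ind=> //.
- by rewrite g0 h0.
- move=> z e; apply: (addrI (g z)); rewrite -gD subrr g0.
  by rewrite e -hD subrr h0.
- by move=> z z' ez ez'; rewrite gD hD ez ez'.
- by move=> r z e; rewrite gZ hZ e.
Qed.

End TensorTheory.

(** Elements of A(t) act by evaluating formal expressions in R, X and Y, so an induction on
    expressions reduces A(t)-linearity to compatibility with R, X and Y. *)
Lemma gwa_mod_linear (R : comNzRingType) (sigma : ringAut R) (t : R)
    (V W : gwa_rep sigma t) (f : V -> W) :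
  {morph f : u v / u + v} -> (forall r v, f (r *: v) = r *: f v) ->
  {morph f : v / repX v} -> {morph f : v / repY v} ->
  exists phi : {linear gwa_mod V -> gwa_mod W}, phi =1 f.
Proof.
move=> fD fZ fX fY.
have f0 : f 0 = 0 by apply: (addrI (f 0)); rewrite -fD !addr0.
have fN v : f (- v) = - f v by apply/eqP; rewrite -addr_eq0 -fD addNr f0.
have fE a v : f (rep_eval a v) = rep_eval a (f v).
  elim: a v => [r|||a iha|a iha b ihb|a iha b ihb] v /=.
  - exact: fZ.
  - exact: fX.
  - exact: fY.
  - by rewrite fN iha.
  - by rewrite fD iha ihb.
  - by rewrite iha ihb.
have fL : linear (f : gwa_mod V -> gwa_mod W).
  move=> a u v; rewrite [LHS]fD; congr (_ + _); exact: fE.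
pose L := GRing.isLinear.Build _ _ _ _ (f : gwa_mod V -> gwa_mod W) fL.
pose phi : {linear gwa_mod V -> gwa_mod W} :=
  HB.pack (f : gwa_mod V -> gwa_mod W) L.
by exists phi.
Qed.

(** * Equality and comaximality of maximal ideals *)

Section MaxSpec.
Variable R : comNzRingType.

(** Besides the predicate, an ideal only carries proofs, which are irrelevant. *)
Lemma idealr_inj (I J : idealr R) : I =i J -> I = J.
Proof.
case: I J => [I cI] [J cJ] IJ.
have e : I = J by apply/funext => x; exact: IJ.
case: J / e cJ {IJ} => cJ; congr (Idealr.Pack _).
case: cI cJ => [[a] [b] [c]] [[a'] [b'] [c']].
congr (Idealr.Class _ _ _); congr (_ _); exact: Prop_irrelevance.
Qed.

Lemma maxSpec_inj (m m' : maxSpec R) : m =i m' -> m = m'.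
Proof.
case: m m' => [m hm] [m' hm'] /= mm'.
have e : m = m' by exact: idealr_inj.
by case: m' / e hm' {mm'} => hm'; congr MaxSpec; exact: Prop_irrelevance.
Qed.

(** An element [u] of [m] outside [m'] has an inverse [b] modulo [m']; then [b * u] lies in [m] and
    [1 - b * u] in [m']. *)
Lemma maxSpec_comaximal (m m' : maxSpec R) : m <> m' ->
  exists a b, [/\ a \in m, b \in m' & a + b = 1].
Proof.
move=> mm'.
(* Otherwise [m] would be contained in [m'], hence equal to it by maximality. *)
have [u um um'] : exists2 u, u \in m & u \notin m'.
  apply: contrapT => h; apply/mm'/esym/maxSpec_inj/(max_idealP (m := m)).
  by move=> u um; apply: contrapT => /negP um'; apply: h; exists u.
have : toRes m' u != 0 by rewrite toRes_eq0.
move=> /residue_has_inv[b]; rewrite -[b]ofResK -rmorphM -(rmorph1 (toRes m')).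
rewrite eq_sym -subr_eq0 -rmorphB toRes_eq0 => bm'.
exists (ofRes b * u), (1 - ofRes b * u); split=> //; last by rewrite addrC subrK.
exact: idealMr.
Qed.

End MaxSpec.

(** * The p ideals of the orbit are pairwise distinct *)

Section PeriodicOrbit.
Variables (R : comNzRingType) (sigma : ringAut R) (m0 : maxSpec R) (p : nat).
Hypothesis sigma_p : forall x : R, iter p sigma x = x.
Hypothesis omega_p : (orbit_of sigma m0 #= `I_p)%card.

Lemma aut_iter_mod (e k : nat) : aut_iter sigma e m0 = m0 ->
  aut_iter sigma (k %% e) m0 = aut_iter sigma k m0.
Proof.
move=> em; rewrite [in RHS](divn_eq k e); elim: (_ %/ _)%N => [|q ih] //.
rewrite mulSn -addnA addnC; rewrite ih /aut_iter [RHS]iterD.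
by congr iter; exact/esym.
Qed.

Lemma aut_iter_inj k : injective (aut_iter sigma k).
Proof.
move=> m m' h; apply: maxSpec_inj => x.
by rewrite -(mem_aut_iter sigma k) h mem_aut_iter.
Qed.

Lemma aut_iter_period : aut_iter sigma p m0 = m0.
Proof.
by apply: maxSpec_inj => x; rewrite -(mem_aut_iter_mod m0 sigma_p p) modnn.
Qed.

(** The orbit contains [m0], so it is not empty. *)
Lemma orbit_size_gt0 : (0 < p)%N.
Proof.
rewrite lt0n; apply/negP => /eqP p0; move: omega_p.
rewrite p0 II0 card_eq0 => /eqP h.
suff : (set0 : set (maxSpec R)) m0 by [].
by rewrite -h; exists 0; left.
Qed.

(** If [e] is a period of [m0], the first [e] iterates exhaust the orbit, which has p elements. *)
Lemma orbit_le_period e :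
  (0 < e)%N -> aut_iter sigma e m0 = m0 -> (p <= e)%N.
Proof.
move=> e0 em; rewrite -card_le_II.
suff h : orbit_of sigma m0 = [set aut_iter sigma k m0 | k in `I_e]%classic.
  move: omega_p; rewrite h card_eq_le => /andP[_ /card_le_trans]; apply.
  exact: card_image_le.
apply/seteqP; split=> m; last by case=> k _ <-; exists k; left.
case=> k [->|km].
  by exists (k %% e)%N; [rewrite /= ltn_pmod|exact: aut_iter_mod].
(* Here [m] is a backward iterate of [m0]. Since [k + j = k * e] is a multiple of the period, going
   [j] steps forward from [m0] also reaches [m]. *)
pose j := (k * e.-1)%N.
have mj : m = aut_iter sigma j m0.
  apply: (@aut_iter_inj k); rewrite -km /aut_iter -iterD -/(aut_iter _ _ _).
  rewrite /j -{1}[k]muln1 -mulnDr add1n prednK //.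
  by rewrite -(aut_iter_mod _ em) modnMl.
by exists (j %% e)%N; [rewrite /= ltn_pmod|rewrite aut_iter_mod].
Qed.

(** Cancelling the smaller number of iterations turns [j - i] into a period of [m0] below p, so it
    must be 0. *)
Lemma aut_iter_orbit_inj i j : (i < p)%N -> (j < p)%N ->
  aut_iter sigma i m0 = aut_iter sigma j m0 -> i = j.
Proof.
wlog ij : i j / (i <= j)%N => [h ip jp e|ip jp].
  by case/orP: (leq_total i j) => ij; [|symmetry]; apply: h.
rewrite -{1}(subnKC ij) /aut_iter iterD => /(@aut_iter_inj i)/esym e.
apply/eqP; rewrite eqn_leq ij -subn_eq0 eqn0Ngt; apply/negP => /orbit_le_period.
by move=> /(_ e); rewrite leqNgt (leq_ltn_trans (leq_subr _ _) jp).
Qed.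

End PeriodicOrbit.

(** * Powers of sigma as ring morphisms *)

Section IterAut.
Variables (R : comNzRingType) (sigma : ringAut R) (k : nat).

Definition iter_aut (x : R) : R := iter k sigma x.
Definition iter_inv (x : R) : R := iter k (aut_inv sigma) x.

Lemma iter_autK : cancel iter_aut iter_inv.
Proof.
rewrite /iter_aut /iter_inv => x.
by elim: k x => [|j ih] x //; rewrite iterSr iterS aut_funK.
Qed.
Lemma iter_invK : cancel iter_inv iter_aut.
Proof.
rewrite /iter_aut /iter_inv => x.
by elim: k x => [|j ih] x //; rewrite iterSr iterS aut_invK.
Qed.

Lemma iter_aut_zmod_morphism : zmod_morphism iter_aut.
Proof. by rewrite /iter_aut; elim: k => //= j ih x y; rewrite ih rmorphB. Qed.
Lemma iter_aut_monoid_morphism : monoid_morphism iter_aut.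
Proof.
rewrite /iter_aut; split; first by elim: k => //= j ->; rewrite rmorph1.
by elim: k => //= j ih x y; rewrite ih rmorphM.
Qed.
HB.instance Definition _ :=
  GRing.isZmodMorphism.Build R R iter_aut iter_aut_zmod_morphism.
HB.instance Definition _ :=
  GRing.isMonoidMorphism.Build R R iter_aut iter_aut_monoid_morphism.

Lemma iter_inv_zmod_morphism : zmod_morphism iter_inv.
Proof. exact: can2_zmod_morphism iter_autK iter_invK. Qed.
Lemma iter_inv_monoid_morphism : monoid_morphism iter_inv.
Proof. exact: can2_monoid_morphism iter_autK iter_invK. Qed.
HB.instance Definition _ :=
  GRing.isZmodMorphism.Build R R iter_inv iter_inv_zmod_morphism.
HB.instance Definition _ :=
  GRing.isMonoidMorphism.Build R R iter_inv iter_inv_monoid_morphism.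

Lemma mem_iter_inv (m : maxSpec R) x :
  (iter_inv x \in m) = (x \in aut_iter sigma k m).
Proof. by rewrite -(mem_aut_iter sigma k) -/(iter_aut _) iter_invK. Qed.

End IterAut.
Arguments iter_aut {R} sigma k x : simpl never.
Arguments iter_inv {R} sigma k x : simpl never.

(** * X and Y in coordinates over the residue field of [m0] *)

Section Coordinates.
Variables (R : comNzRingType) (sigma : ringAut R) (m0 : maxSpec R).
Variables (n d : nat).
Local Notation V := (string_sum sigma m0 n d).
Local Notation K := (residue m0).

(* The k-th block of a vector, transported to (R/m0)^d by sigma^-(k+1); in these
   coordinates X and Y act by matrices over R/m0 that do not involve sigma. *)
Definition scoord (v : V) (k : 'I_n) : 'cV[K]_d :=
  \col_i res_map (iter_inv sigma k.+1) (dsum_coord v (k, i)).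

Definition string_of (f : 'I_n -> 'cV[K]_d) : V :=
  dsum_of (fun ks : 'I_n * 'I_d =>
    res_map (iter_aut sigma ks.1.+1) (f ks.1 ks.2 0) : string_comp sigma m0 ks).

Lemma res_map_iter_inv k x :
  res_map (iter_inv sigma k) (toRes (aut_iter sigma k m0) x) =
  toRes m0 (iter_inv sigma k x).
Proof. by apply: res_map_toRes => y; rewrite mem_iter_inv. Qed.

Lemma res_map_iter_aut k x :
  res_map (iter_aut sigma k) (toRes m0 x) =
  toRes (aut_iter sigma k m0) (iter_aut sigma k x).
Proof. by apply: res_map_toRes => y; rewrite -mem_iter_inv iter_autK. Qed.

Lemma string_ofK f : scoord (string_of f) =1 f.
Proof.
move=> k; apply/colP => i; rewrite !mxE /= dsum_ofE /= -{1}[f k i 0]ofResK.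
by rewrite res_map_iter_aut res_map_iter_inv iter_autK ofResK.
Qed.

(** The power sigma^-(k+1) carries the ideal of block [k] exactly onto [m0], so it is injective on
    residues. *)
Lemma scoord_inj (u v : V) : scoord u =1 scoord v -> u = v.
Proof.
move=> uv; apply: dsumP => -[k i].
have /colP/(_ i) := uv k; rewrite !mxE.
rewrite -[dsum_coord u _](@ofResK _ (aut_iter sigma k.+1 m0)).
rewrite -[dsum_coord v _](@ofResK _ (aut_iter sigma k.+1 m0)).
rewrite !res_map_iter_inv => /eqP; rewrite -subr_eq0 -!rmorphB toRes_eq0.
by rewrite mem_iter_inv => /eq_toRes.
Qed.

Lemma scoordD u v k : scoord (u + v) k = scoord u k + scoord v k.
Proof.
apply/colP => i; rewrite !mxE dsum_coordD; apply: res_mapD => x.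
by rewrite mem_iter_inv.
Qed.

Lemma scoordZ r v k :
  scoord (r *: v) k = toRes m0 (iter_inv sigma k.+1 r) *: scoord v k.
Proof.
apply/colP => i; rewrite !mxE dsum_coordZ residueZE -res_map_iter_inv.
by apply: res_mapM => x; rewrite mem_iter_inv.
Qed.

Lemma scoord0 k : scoord 0 k = 0.
Proof. by rewrite -(scale0r 0) scoordZ !rmorph0 scale0r. Qed.

Lemma scoord_sum (J : Type) (s : seq J) (P : pred J) (G : J -> V) k :
  scoord (\sum_(j <- s | P j) G j) k = \sum_(j <- s | P j) scoord (G j) k.
Proof.
by apply: (big_morph (scoord^~ k)) => [u v|]; [exact: scoordD|exact: scoord0].
Qed.

Lemma scoord_inj_in (k : 'I_n) (s : 'I_d) (a : string_comp sigma m0 (k, s)) :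
  scoord (dsum_inj (string_comp sigma m0 (d:=d)) (k, s) a) k =
  res_map (iter_inv sigma k.+1) a *: delta_mx s 0.
Proof.
apply/colP => i; rewrite !mxE eqxx andbT.
have [->|si] := eqVneq i s; first by rewrite dsum_coord_inj mulr1.
rewrite mulr0 dsum_coord_inj_out; last by apply: contraNneq si => -[->].
by apply: res_map0 => x; rewrite mem_iter_inv.
Qed.

Lemma scoord_inj_out (k l : 'I_n) (s : 'I_d) (a : string_comp sigma m0 (k, s)) :
  k != l -> scoord (dsum_inj (string_comp sigma m0 (d:=d)) (k, s) a) l = 0.
Proof.
move=> kl; apply/colP => i; rewrite !mxE dsum_coord_inj_out.
  by apply: res_map0 => x; rewrite mem_iter_inv.
by apply: contraNneq kl => -[->].
Qed.

Lemma scoord_basis k s l :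
  scoord (string_basis sigma m0 k s) l = (k == l)%:R *: delta_mx s 0.
Proof.
have [<-|kl] := eqVneq k l; last by rewrite scale0r scoord_inj_out.
rewrite scoord_inj_in; congr (_ *: _).
by apply: res_map1 => x; rewrite mem_iter_inv.
Qed.

(** The hypothesis says that [f] agrees with the transport from [m0] to block [k]. It is met by
    sigma on the first block, as needed for X, and by the identity on the last block, as needed for
    Y. *)
Lemma scoord_col (f : {rmorphism R -> R}) (G : 'M[K]_d) (k l : 'I_n) (s : 'I_d) :
  (forall x, iter_inv sigma k.+1 (f x) = x) ->
  scoord (string_col sigma f G k s) l = (k == l)%:R *: col s G.
Proof.
move=> kf; rewrite scoord_sum.
have [<-|kl] := eqVneq k l; last first.
  by rewrite scale0r big1 // => i _; rewrite scoord_inj_out.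
rewrite scale1r; apply/colP => j; rewrite summxE (bigD1 j) //=.
rewrite scoord_inj_in !mxE !eqxx mulr1 big1 ?addr0 => [|i ij]; last first.
  by rewrite scoord_inj_in !mxE eq_sym (negPf ij) mulr0.
rewrite -{1}[G j s]ofResK (res_map_toRes (f := f)); last first.
  by move=> x; rewrite -mem_iter_inv kf.
by rewrite res_map_iter_inv kf ofResK.
Qed.

Lemma scoord_ext (f : R -> R) (E : 'I_n -> 'I_d -> V) v k :
  scoord (string_ext f E v) k = \sum_l \sum_s
    toRes m0 (iter_inv sigma k.+1 (f (ofRes (dsum_coord v (l, s))))) *:
    scoord (E l s) k.
Proof.
rewrite /string_ext scoord_sum pair_bigA; apply: eq_bigr => -[l s] _ /=.
exact: scoordZ.
Qed.

Lemma mulmx_sum_col (A : 'M[K]_d) (v : 'cV[K]_d) :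
  \sum_i v i 0 *: col i A = A *m v.
Proof.
apply/colP => j; rewrite summxE mxE; apply: eq_bigr => i _.
by rewrite !mxE mulrC.
Qed.

Variables (t : R) (w : n.-tuple letter) (F : 'M[K]_d).
Hypothesis sigma_n : forall x : R, iter n sigma x = x.

Lemma iter_inv_period x : iter_inv sigma n x = x.
Proof. by rewrite -{1}[x](sigma_n x) -/(iter_aut _ _ _) iter_autK. Qed.

Lemma iter_inv_mod k x : iter_inv sigma (k %% n) x = iter_inv sigma k x.
Proof.
rewrite [in RHS](divn_eq k n); elim: (_ %/ _)%N => [|q ih] //.
rewrite ih mulSn -addnA /iter_inv [RHS]iterD -!/(iter_inv _ _ _).
by rewrite iter_inv_period.
Qed.

(** For the letter 1, the factor [sigma t] sits on the block after [k], so the transport by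
    sigma^-(k+2) leaves sigma^-(k+1)(t). *)
Definition xcoef (k : 'I_n) : K :=
  match tnth w k with
  | L1 => toRes m0 (iter_inv sigma k.+1 t) | Lx => 1 | Ly | L0 => 0
  end.
Definition ycoef (k : 'I_n) : K :=
  match tnth w k with L1 | Ly => 1 | Lx | L0 => 0 end.
Definition wrap_mx (A : 'M[K]_d) (k : 'I_n) : 'M[K]_d :=
  if k.+1 == n then A else 1%:M.

Lemma iter_inv_ordS (k : 'I_n) x :
  iter_inv sigma (ordS k).+1 (sigma x) = iter_inv sigma k.+1 x.
Proof. by rewrite /iter_inv iterSr aut_funK; exact: iter_inv_mod. Qed.

Lemma scoord_X v k :
  scoord (string_X t w F v) (ordS k) = xcoef k *: (wrap_mx F k *m scoord v k).
Proof.
pose e (k : 'I_n) (s : 'I_d) :=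
  if k.+1 == n then string_col sigma sigma F (ordS k) s
  else string_basis sigma m0 (ordS k) s.
have eE l s : scoord (e l s) (ordS k) = (l == k)%:R *: col s (wrap_mx F l).
  rewrite -(inj_eq (@ordS_inj n)) /e /wrap_mx; case: ifPn => ln.
    apply: (scoord_col (f := aut_fun sigma)) => x.
    by rewrite iter_inv_ordS (eqP ln) iter_inv_period.
  by rewrite scoord_basis col1.
have XeE l s : scoord (string_Xe sigma t w F l s) (ordS k) =
    (l == k)%:R *: (xcoef k *: col s (wrap_mx F k)).
  rewrite /string_Xe -/(e l s) /xcoef.
  have [->|lk] := eqVneq l k; case: (tnth w _); rewrite ?scoordZ ?scoord0 ?eE
    ?eqxx ?(negPf lk) ?scale0r ?scaler0 ?scale1r ?iter_inv_ordS //.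
rewrite scoord_ext (bigD1 k) //= [X in _ + X]big1 => [|l lk]; last first.
  by rewrite big1 // => s _; rewrite XeE (negPf lk) scale0r scaler0.
rewrite addr0 -mulmx_sum_col scaler_sumr; apply: eq_bigr => s _.
have /= iE := iter_inv_ordS k.
rewrite XeE eqxx scale1r !scalerA iE mulrC mxE.
by rewrite -res_map_iter_inv ofResK.
Qed.

(** [string_Ye] detects the turn at the first index, [wrap_mx] at the last one; this reconciles the
    two conventions. *)
Lemma wrap_mxE A (k : 'I_n) :
  (if ordS k == 0%N :> nat then A else 1%:M) = wrap_mx A k.
Proof.
rewrite /wrap_mx; have [kn|kn] := eqVneq k.+1 n; first by rewrite ordS_last.
by rewrite ordS_nlast.
Qed.

Lemma scoord_Y v k :
  scoord (string_Y w F v) k =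
  ycoef k *: (wrap_mx (invmx F) k *m scoord v (ordS k)).
Proof.
pose e (k : 'I_n) (s : 'I_d) :=
  if k == 0%N :> nat then string_col sigma id (invmx F) (ord_pred k) s
  else string_basis sigma m0 (ord_pred k) s.
have eE l s :
    scoord (e (ordS l) s) k = (l == k)%:R *: col s (wrap_mx (invmx F) l).
  rewrite /e ordSK -wrap_mxE; case: ifPn => ln; last by rewrite scoord_basis col1.
  apply: (scoord_col (f := idfun)) => x.
  have [kn|kn] := eqVneq l.+1 n; first by rewrite kn iter_inv_period.
  by move: ln; rewrite ordS_nlast.
have YeE l s : scoord (string_Ye sigma w F (ordS l) s) k =
    (l == k)%:R *: (ycoef k *: col s (wrap_mx (invmx F) k)).
  rewrite /string_Ye -/(e (ordS l) s) /ycoef ordSK.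
  have [->|lk] := eqVneq l k; case: (tnth w _); rewrite ?scoord0 ?eE
    ?eqxx ?(negPf lk) ?scale0r ?scaler0 ?scale1r //.
rewrite scoord_ext (bigD1 (ordS k)) //= [X in _ + X]big1 => [|l lk]; last first.
  rewrite big1 // => s _; rewrite -[l]ord_predK YeE.
  rewrite -(inj_eq (@ordS_inj n)) ord_predK (negPf lk).
  by rewrite scale0r scaler0.
rewrite addr0 -mulmx_sum_col scaler_sumr; apply: eq_bigr => s _.
rewrite YeE eqxx scale1r !scalerA mulrC mxE.
congr (_ * _ *: _).
rewrite -[in RHS](ofResK (dsum_coord v (ordS k, s) : residue _)) res_map_iter_inv.
by rewrite -iter_inv_ordS aut_invK.
Qed.

End Coordinates.

(** * Blocks of string modules under restriction to R *)

Section StringRes.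
Variables (R : comNzRingType) (sigma : ringAut R) (m0 : maxSpec R).
Variables (t : R) (n d : nat) (w : n.-tuple letter) (F : 'M[residue m0]_d).
Hypothesis sigma_n : forall x : R, iter n sigma x = x.
Hypothesis wD : in_D sigma m0 t 1 w.
Hypothesis F_unit : F \in unitmx.
Local Notation M := (gwa_res (string_mod sigma_n wD F_unit)).
Local Notation V := (string_sum sigma m0 n d).

(** This lemma and the next two carry the coordinate formulas over to [M], where R, X and Y act
    through A(t). *)
Lemma scoord_resZ x (u : M) k :
  scoord (x *: u : V) k = toRes m0 (iter_inv sigma k.+1 x) *: scoord (u : V) k.
Proof.
have -> : x *: u = (x *: (u : V) : V).
  exact: (@gwa_mod_C _ _ _ (string_rep sigma_n wD F_unit)).
exact: scoordZ.
Qed.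

Lemma scoord_resX (u : M) k :
  scoord (res_op (gwaX sigma t) u : V) (ordS k) =
  xcoef sigma m0 t w k *: (wrap_mx F k *m scoord (u : V) k).
Proof.
rewrite -scoord_X //; congr (scoord _ _).
exact: (@gwa_mod_X _ _ _ (string_rep sigma_n wD F_unit)).
Qed.

Lemma scoord_resY (u : M) k :
  scoord (res_op (gwaY sigma t) u : V) k =
  ycoef m0 w k *: (wrap_mx (invmx F) k *m scoord (u : V) (ordS k)).
Proof.
rewrite -(scoord_Y w F sigma_n); congr (scoord _ _).
exact: (@gwa_mod_Y _ _ _ (string_rep sigma_n wD F_unit)).
Qed.

Lemma res_block_annihilated (k : 'I_n) x (u : M) :
  (forall l, l != k -> scoord (u : V) l = 0) -> x \in aut_iter sigma k.+1 m0 ->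
  x *: u = 0.
Proof.
move=> u0 xk; apply: (@scoord_inj _ _ _ _ _ (x *: u : V) 0) => l.
rewrite scoord_resZ scoord0.
have [->|lk] := eqVneq l k; last by rewrite u0 ?scaler0.
by move: xk; rewrite -mem_iter_inv -toRes_eq0 => /eqP ->; rewrite scale0r.
Qed.

End StringRes.

(** Each factor is annihilated by the ideal of its block, and the two distinct maximal ideals are
    comaximal. *)
Lemma tens_block_neq (R : comNzRingType) (sigma : ringAut R) (m0 : maxSpec R)
    (t t' : R) (n n' d d' : nat) (w : n.-tuple letter) (w' : n'.-tuple letter)
    (F : 'M[residue m0]_d) (F' : 'M[residue m0]_d')
    (sigma_n : forall x : R, iter n sigma x = x)
    (sigma_n' : forall x : R, iter n' sigma x = x)
    (wD : in_D sigma m0 t 1 w) (wD' : in_D sigma m0 t' 1 w')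
    (F_unit : F \in unitmx) (F_unit' : F' \in unitmx)
    (u : gwa_res (string_mod sigma_n wD F_unit))
    (v : gwa_res (string_mod sigma_n' wD' F_unit')) (k : 'I_n) (l : 'I_n') :
  aut_iter sigma k m0 <> aut_iter sigma l m0 ->
  (forall j, j != k -> scoord (u : string_sum sigma m0 n d) j = 0) ->
  (forall j, j != l -> scoord (v : string_sum sigma m0 n' d') j = 0) ->
  tens u v = 0.
Proof.
move=> kl u0 v0.
have [|a [b [am bm ab]]] := @maxSpec_comaximal _ (aut_iter sigma k.+1 m0)
  (aut_iter sigma l.+1 m0).
  (* Block [k] lies over the iterate of index [k.+1]; one application of sigma is cancelled to reach
     the hypothesis on [k] and [l]. *)
  by move=> /(@aut_iter_inj _ sigma 1).
by apply: (tens_coprime_annihilators ab); apply: res_block_annihilated;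
  eassumption.
Qed.

(** * The isomorphism and its inverse *)

Section TensorOfStrings.
Variables (R : comNzRingType) (sigma : ringAut R) (p : nat).
Variables (m0 : maxSpec R) (t : R) (r d : nat) (w : (r * p).-tuple letter).
Variable F : 'M[residue m0]_d.
Hypothesis sigma_p : forall x : R, iter p sigma x = x.
Hypothesis omega_p : (orbit_of sigma m0 #= `I_p)%card.
Hypothesis wD : in_D sigma m0 t 1 w.
Hypothesis F_unit : F \in unitmx.

Local Notation n := (r * p)%N.
Local Notation M1 := (string_mod (w := [tuple of nseq p L1]) sigma_p
           (@in_D_ones R sigma m0 1 p) F_unit).
Local Notation M2 := (string_mod (F := 1%:M : 'M_1) (iter_mul_id r sigma_p) wD
           (unitmx1 _ 1)).
Local Notation V1 := (string_sum sigma m0 p d).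
Local Notation V2 := (string_sum sigma m0 n 1).
Local Notation V := (string_sum sigma m0 n d).
Local Notation T := (tensor (gwa_res M1) (gwa_res M2)).

Let p_gt0 : (0 < p)%N := orbit_size_gt0 omega_p.

(** The block of V^1 over the same maximal ideal as block [k] of V^t. *)
Definition residue_ord (k : 'I_n) : 'I_p := Ordinal (ltn_pmod k p_gt0).

Lemma residue_ord_ordS k : residue_ord (ordS k) = ordS (residue_ord k).
Proof.
apply: val_inj; rewrite /= modn_dvdm ?dvdn_mull //.
by rewrite -addn1 -[in RHS]addn1 modnDml.
Qed.

Lemma iter_inv_residue_ord (k : 'I_n) x :
  iter_inv sigma (residue_ord k).+1 x = iter_inv sigma k.+1 x.
Proof.
rewrite -(iter_inv_mod sigma_p k.+1) -(iter_inv_mod sigma_p _.+1) /=.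
by rewrite -addn1 modnDml addn1.
Qed.

Definition twist (k : 'I_n) : 'M[residue m0]_d := F ^+ (r.-1 - k %/ p).

(** Inside a turn the exponent of [twist] is constant and no matrix is applied. At the end of a turn
    it drops by one, which absorbs the F on the left. At the end of the word it jumps from 0 back to
    [r.-1], and with that F this makes [F ^+ r]. *)
Lemma twist_ordS k :
  twist (ordS k) *m wrap_mx F (residue_ord k) = wrap_mx (F ^+ r) k *m twist k.
Proof.
rewrite /twist /wrap_mx /=.
have kE := divn_eq k p.
have qr : (k %/ p < r)%N by rewrite ltn_divLR.
have jp : (k %% p < p)%N by rewrite ltn_pmod.
move: (k %/ p)%N (k %% p)%N kE qr jp => q j kE qr jp.
have [jE|jE] := eqVneq j.+1 p.
  have kS : k.+1 = (q.+1 * p)%N by rewrite kE -addnS jE mulSn addnC.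
  rewrite kS eqn_pmul2r //; have [qE|qE] := eqVneq q.+1 r.
    rewrite qE modnn div0n subn0 -qE /= subnn expr0 mulmx1 exprSr.
    by rewrite mulmxE.
  have qr' : (q.+1 < r)%N by rewrite ltn_neqAle qE.
  rewrite modn_small ?ltn_pmul2r // mulnK // mul1mx.
  rewrite mulmxE -exprSr; congr (_ ^+ _).
  (* The bound [qr'] keeps the truncated subtraction exact. *)
  by case: (r) qr' => // r' /=; rewrite ltnS => /subnSK.
have jp' : (j.+1 < p)%N by rewrite ltn_neqAle jE.
(* Strictly inside a turn, [k.+1] is not a multiple of p, so the word does not end there. *)
have kn : k.+1 != n.
  apply: contraNneq jE => kS; have := congr1 (modn^~ p) kS.
  by rewrite modnMl kE -addnS modnMDl modn_small.
rewrite (negPf kn) modn_small; last by rewrite ltn_neqAle kn ltn_ord.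
by rewrite kE -addnS divnMDl // divn_small // addn0 mulmx1 mul1mx.
Qed.

Lemma wrap_mx_unit m (A : 'M[residue m0]_d) (k : 'I_m) :
  A \in unitmx -> wrap_mx A k \in unitmx.
Proof. by rewrite /wrap_mx; case: ifP => // _; rewrite unitmx1. Qed.

Lemma wrap_mxV m (A : 'M[residue m0]_d) (k : 'I_m) :
  wrap_mx (invmx A) k = invmx (wrap_mx A k).
Proof. by rewrite /wrap_mx; case: ifP => // _; rewrite invmx1. Qed.

(** This is [twist_ordS] multiplied by the inverses of both wrap matrices, in the form that Y
    requires. *)
Lemma twist_ordSV k :
  twist k *m wrap_mx (invmx F) (residue_ord k) =
  wrap_mx (invmx (F ^+ r)) k *m twist (ordS k).
Proof.
have Fr := unitmx_exp r F_unit.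
rewrite !wrap_mxV; apply: (can_inj (mulKmx (wrap_mx_unit k Fr))).
rewrite mulKVmx ?wrap_mx_unit // mulmxA -twist_ordS mulmxK //.
exact: wrap_mx_unit.
Qed.

Lemma twist_unit k : twist k \in unitmx.
Proof. exact: unitmx_exp. Qed.

(** The blocks of V^t have dimension 1, so their coordinates act as scalars on the matching blocks
    of V^1. *)
Definition pair_map (u : gwa_res M1) (v : gwa_res M2) : V :=
  string_of sigma (fun k =>
    scoord (v : V2) k 0 0 *: (twist k *m scoord (u : V1) (residue_ord k))).

Lemma pair_mapE u v k : scoord (pair_map u v) k =
  scoord (v : V2) k 0 0 *: (twist k *m scoord (u : V1) (residue_ord k)).
Proof. exact: string_ofK. Qed.

Lemma pair_mapDl u u' v : pair_map (u + u') v = pair_map u v + pair_map u' v.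
Proof.
apply: scoord_inj => k; rewrite [RHS]scoordD [LHS]pair_mapE.
rewrite [X in _ = X + _]pair_mapE [X in _ = _ + X]pair_mapE.
by rewrite (scoordD (u : V1) (u' : V1)) mulmxDr scalerDr.
Qed.

Lemma pair_mapDr u v v' : pair_map u (v + v') = pair_map u v + pair_map u v'.
Proof.
apply: scoord_inj => k; rewrite [RHS]scoordD [LHS]pair_mapE.
rewrite [X in _ = X + _]pair_mapE [X in _ = _ + X]pair_mapE.
by rewrite (scoordD (v : V2) (v' : V2)) mxE scalerDl.
Qed.

Lemma pair_mapZl x u v : pair_map (x *: u) v = x *: pair_map u v.
Proof.
apply: scoord_inj => k; rewrite [RHS]scoordZ [X in _ = _ *: X]pair_mapE.
rewrite [LHS]pair_mapE scoord_resZ.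
by rewrite iter_inv_residue_ord -scalemxAr !scalerA mulrC.
Qed.

Lemma pair_mapZr x u v : pair_map u (x *: v) = x *: pair_map u v.
Proof.
apply: scoord_inj => k; rewrite [RHS]scoordZ [X in _ = _ *: X]pair_mapE.
rewrite [LHS]pair_mapE scoord_resZ.
by rewrite mxE !scalerA.
Qed.

Lemma xcoef_ones k : xcoef sigma m0 1 [tuple of nseq p L1] k = 1.
Proof. by rewrite /xcoef (tnth_nth L1) nth_nseq if_same !rmorph1. Qed.
Lemma ycoef_ones k : ycoef m0 [tuple of nseq p L1] k = 1.
Proof. by rewrite /ycoef (tnth_nth L1) nth_nseq if_same. Qed.
Lemma wrap_mx1 m e (k : 'I_m) : wrap_mx (1%:M : 'M[residue m0]_e) k = 1%:M.
Proof. by rewrite /wrap_mx if_same. Qed.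

Lemma pair_mapX u v :
  pair_map (res_op (gwaX sigma 1) u) (res_op (gwaX sigma t) v) =
  string_X t w (F ^+ r) (pair_map u v).
Proof.
have sn := iter_mul_id r sigma_p.
(* X is described on successor blocks, and cyclically every block is one. *)
apply: scoord_inj => k; rewrite -[k]ord_predK; move: (ord_pred k) => {}k.
rewrite [RHS]scoord_X // [X in _ = _ *: (_ *m X)]pair_mapE [LHS]pair_mapE.
rewrite residue_ord_ordS !scoord_resX xcoef_ones wrap_mx1.
by rewrite mul1mx scale1r mulmxA twist_ordS mxE -scalemxAr -mulmxA scalerA.
Qed.

Lemma pair_mapY u v :
  pair_map (res_op (gwaY sigma 1) u) (res_op (gwaY sigma t) v) =
  string_Y w (F ^+ r) (pair_map u v).
Proof.
have sn := iter_mul_id r sigma_p.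
apply: scoord_inj => k.
rewrite [RHS]scoord_Y // [X in _ = _ *: (_ *m X)]pair_mapE [LHS]pair_mapE.
rewrite residue_ord_ordS !scoord_resY ycoef_ones.
rewrite invmx1 wrap_mx1.
by rewrite mul1mx scale1r mulmxA twist_ordSV mxE -scalemxAr -mulmxA scalerA.
Qed.

Definition tens_to_string : T -> V := tens_lift pair_map.

Lemma tens_to_stringD : {morph tens_to_string : y z / y + z}.
Proof.
exact: tens_liftD pair_mapDl pair_mapDr pair_mapZl pair_mapZr.
Qed.
Lemma tens_to_stringZ x z : tens_to_string (x *: z) = x *: tens_to_string z.
Proof.
exact: tens_liftZ pair_mapDl pair_mapDr pair_mapZl pair_mapZr _ _.
Qed.
Lemma tens_to_string_tens u v : tens_to_string (tens u v) = pair_map u v.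
Proof.
exact: tens_lift_tens pair_mapDl pair_mapDr pair_mapZl pair_mapZr _ _.
Qed.

Lemma tens_to_stringX z :
  tens_to_string (tensX z) = string_X t w (F ^+ r) (tens_to_string z).
Proof.
have sn := iter_mul_id r sigma_p; move: z.
(* Both sides are semilinear along sigma, so pure tensors suffice. *)
apply: (@tens_ext _ _ _ _ (fun x (v : V) => sigma x *: v)).
- by move=> y z; rewrite tensXD tens_to_stringD.
- by move=> y z; rewrite tens_to_stringD string_XD.
- by move=> x z; rewrite tensXZ tens_to_stringZ.
- by move=> x z; rewrite tens_to_stringZ string_XZ.
- by move=> u v; rewrite tensX_tens !tens_to_string_tens pair_mapX.
Qed.

Lemma tens_to_stringY z :
  tens_to_string (tensY z) = string_Y w (F ^+ r) (tens_to_string z).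
Proof.
have sn := iter_mul_id r sigma_p; move: z.
apply: (@tens_ext _ _ _ _ (fun x (v : V) => aut_inv sigma x *: v)).
- by move=> y z; rewrite tensYD tens_to_stringD.
- by move=> y z; rewrite tens_to_stringD string_YD.
- by move=> x z; rewrite tensYZ tens_to_stringZ.
- by move=> x z; rewrite tens_to_stringZ string_YZ.
- by move=> u v; rewrite tensY_tens !tens_to_string_tens pair_mapY.
Qed.

Definition block (l : 'I_p) (x : 'cV[residue m0]_d) : gwa_res M1 :=
  string_of sigma (fun j => (j == l)%:R *: x) : V1.

Lemma blockE l x j : scoord (block l x : V1) j = (j == l)%:R *: x.
Proof. exact: string_ofK. Qed.

Definition string_gen (k : 'I_n) : gwa_res M2 :=
  string_basis sigma m0 k (ord0 : 'I_1).

Lemma string_genE k j : scoord (string_gen k : V2) j 0 0 = (j == k)%:R.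
Proof. by rewrite scoord_basis !mxE eqxx mulr1 eq_sym. Qed.

Lemma blockD l x y : block l (x + y) = block l x + block l y.
Proof.
apply: (@scoord_inj _ _ _ _ _ (block l (x + y) : V1)
  ((block l x : V1) + (block l y : V1))) => j.
by rewrite scoordD !blockE scalerDr.
Qed.

(** As sigma^p is the identity, R acts by the same scalars on block [k] and on its partner in
    V^1. *)
Lemma block_residue_ordZ (k : 'I_n) x y :
  block (residue_ord k) (toRes m0 (iter_inv sigma k.+1 x) *: y) =
  x *: block (residue_ord k) y.
Proof.
apply: (@scoord_inj _ _ _ _ _ (block _ _ : V1)
  (x *: block (residue_ord k) y : V1)) => j.
rewrite scoord_resZ !blockE; have [->|_] := eqVneq j (residue_ord k).
  by rewrite iter_inv_residue_ord !scale1r.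
by rewrite !scale0r scaler0.
Qed.

Definition string_to_tens (v : V) : T :=
  \sum_(k < n)
    tens (block (residue_ord k) (invmx (twist k) *m scoord v k)) (string_gen k).

Lemma string_to_tensD : {morph string_to_tens : y z / y + z}.
Proof.
move=> y z; rewrite /string_to_tens -big_split /=; apply: eq_bigr => k _.
by rewrite -tensDl -blockD scoordD mulmxDr.
Qed.

Lemma string_to_tensZ x v : string_to_tens (x *: v) = x *: string_to_tens v.
Proof.
rewrite /string_to_tens scaler_sumr; apply: eq_bigr => k _.
by rewrite scoordZ -scalemxAr block_residue_ordZ tensZl.
Qed.

Lemma string_to_tensK : cancel string_to_tens tens_to_string.
Proof.
move=> v.
rewrite (big_morph tens_to_string tens_to_stringD (id1 := 0)); last first.
  by rewrite -(scale0r 0) tens_to_stringZ scale0r.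
apply: scoord_inj => k; rewrite scoord_sum (bigD1 k) //= big1 ?addr0.
  rewrite tens_to_string_tens pair_mapE string_genE blockE !eqxx !scale1r.
  by rewrite mulKVmx ?twist_unit.
move=> l lk; rewrite tens_to_string_tens pair_mapE string_genE eq_sym (negPf lk).
by rewrite scale0r.
Qed.

Lemma blocks_sum (u : gwa_res M1) : u = \sum_l block l (scoord (u : V1) l).
Proof.
apply: (@scoord_inj _ _ _ _ _ (u : V1)
  (\sum_l (block l (scoord (u : V1) l) : V1))) => j.
rewrite [RHS]scoord_sum (bigD1 j) //= blockE eqxx scale1r big1 ?addr0 // => l lj.
by rewrite blockE eq_sym (negPf lj) scale0r.
Qed.

(** An element of R acting on block [k] as the scalar [a]; only scalars from R can cross the tensor
    sign. *)
Definition lift_coef (k : 'I_n) (a : residue m0) : R :=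
  iter_aut sigma k.+1 (ofRes a).

Lemma lift_coefK (k : 'I_n) a :
  toRes m0 (iter_inv sigma k.+1 (lift_coef k a)) = a.
Proof. by rewrite iter_autK ofResK. Qed.

Lemma string_gen_sum (v : gwa_res M2) :
  v = \sum_k lift_coef k (scoord (v : V2) k 0 0) *: string_gen k.
Proof.
apply: (@scoord_inj _ _ _ _ _ (v : V2)
  (\sum_k (lift_coef k (scoord (v : V2) k 0 0) *: string_gen k : V2))) => j.
apply/colP => i; rewrite (ord1 i) scoord_sum (bigD1 j) //= big1 => [|l lj].
  by rewrite addr0 scoord_resZ [RHS]mxE lift_coefK string_genE eqxx mulr1.
apply/colP => i'; rewrite (ord1 i') scoord_resZ mxE string_genE.
by rewrite eq_sym (negPf lj) mulr0 mxE.
Qed.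

(** On a pure tensor, expand the right factor along the generators and the left one into blocks: for
    each [k], only the block of index k mod p survives. *)
Lemma tens_to_stringK : cancel tens_to_string string_to_tens.
Proof.
apply: (@tens_ext _ _ _ _ (fun x (z : T) => x *: z)) => //.
- by move=> y z; rewrite tens_to_stringD string_to_tensD.
- by move=> x z; rewrite tens_to_stringZ string_to_tensZ.
move=> u v; rewrite tens_to_string_tens [in RHS](string_gen_sum v) tens_sumr.
apply: eq_bigr => k _; rewrite pair_mapE -scalemxAr mulKmx ?twist_unit //.
rewrite -{1}(lift_coefK k (scoord (v : V2) k 0 0)) block_residue_ordZ.
rewrite tensZl tensZr.
congr (_ *: _); rewrite [in RHS](blocks_sum u) tens_suml.
rewrite (bigD1 (residue_ord k)) //= big1 ?addr0 // => l lk.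
(* The other blocks lie over different ideals, because the orbit has exactly p elements. *)
apply: (@tens_block_neq _ _ _ _ _ _ _ _ _ _ _ _ _ _ _ _ _ _ _ _ _ l k).
- rewrite -(aut_iter_mod k (aut_iter_period m0 sigma_p)).
  move=> /(aut_iter_orbit_inj omega_p (ltn_ord l) (ltn_pmod k p_gt0)) e.
  by case/eqP: lk; apply: val_inj.
- by move=> j jl; rewrite blockE (negPf jl) scale0r.
- by move=> j jk; apply/colP => i; rewrite (ord1 i) string_genE (negPf jk) mxE.
Qed.

End TensorOfStrings.

Theorem lemma3p4 (R : comNzRingType) (sigma : ringAut R) (p : nat)
    (m0 : maxSpec R) (t : R) (r d : nat) (w : (r * p).-tuple letter)
    (F : 'M[residue m0]_d)
    (sigma_p : forall x : R, iter p sigma x = x)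
    (omega_p : (orbit_of sigma m0 #= `I_p)%card)
    (t_reg : GRing.lreg t)
    (r_gt0 : (0 < r)%N)
    (wD : in_D sigma m0 t 1 w)
    (F_unit : F \in unitmx) :
  exists phi : {linear
      gwa_tensor
        (string_mod (w := [tuple of nseq p L1]) sigma_p
           (@in_D_ones R sigma m0 1 p) F_unit)
        (string_mod (F := 1%:M : 'M_1) (iter_mul_id r sigma_p) wD
           (unitmx1 _ 1))
        (esym (mul1r t))
      -> string_mod (iter_mul_id r sigma_p) wD (unitmx_exp r F_unit)},
    bijective phi.
Proof.
(* The map induced on the tensor product by [pair_map] commutes with R, X and Y, which gives
   A(t)-linearity. *)
have [|||| phi phiE] := @gwa_mod_linear _ _ _
  (tens_rep
    (string_mod (w := [tuple of nseq p L1]) sigma_p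
       (@in_D_ones R sigma m0 1 p) F_unit)
    (string_mod (F := 1%:M : 'M_1) (iter_mul_id r sigma_p) wD (unitmx1 _ 1))
    (esym (mul1r t)))
  (string_rep (iter_mul_id r sigma_p) wD (unitmx_exp r F_unit))
  (@tens_to_string R sigma p m0 t r d w F sigma_p omega_p wD F_unit).
- exact: tens_to_stringD.
- exact: tens_to_stringZ.
- exact: tens_to_stringX.
- exact: tens_to_stringY.
exists phi.
exists (@string_to_tens R sigma p m0 t r d w F sigma_p omega_p wD F_unit) => z;
  rewrite phiE.
  exact: tens_to_stringK.
exact: string_to_tensK.
Qed.
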